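(* For all $0<\varepsilon,\alpha<1$ and every $3$-partite $3$-graph $F$ with $f$ vertices, there exist $n_0\in\mathbb{N}$ and $\mu>0$ such that the following holds for all $n\ge n_0$: if $H$ is an $(n,\tfrac18+\varepsilon,\mu,\cdot)$ $3$-graph with $\delta_2(H)\ge\alpha n$ and $f\mid n$, then $H$ has an $F$-factor.
   Context: A $k$-graph $H=(V(H),E(H))$ has edge set $E(H)\subseteq\binom{V(H)}{k}$. For $S\subseteq V(H)$ with $1\le|S|\le k-1$, $\deg_H(S)$ is the number of edges containing $S$, and $\delta_s(H)$ is the minimum of $\deg_H(S)$ over all $s$-subsets $S$ of $V(H)$. A $k$-graph $F$ is $k$-partite if $V(F)$ can be partitioned into $k$ classes such that every edge meets each class in exactly one vertex. An $F$-factor in $H$ is a set of vertex-disjoint copies of $F$ in $H$ covering $V(H)$. An $(n,p,\mu,\cdot)$ $k$-graph is a $k$-graph $H$ on a vertex set $V$ with $|V|=n$ such that for all $X_1,\dots,X_k\subseteq V$, the number of $k$-tuples $(x_1,\dots,x_k)\in X_1\times\cdots\times X_k$ with $\{x_1,\dots,x_k\}\in E(H)$ is at least $p|X_1|\cdots|X_k|-\mu n^k$. *)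

(* Defs.v *)
From HB Require Import structures.
From mathcomp Require Import all_boot all_order all_algebra.
From mathcomp Require Import reals.
Set Implicit Arguments. Unset Strict Implicit. Unset Printing Implicit Defensive.
Import Order.TTheory GRing.Theory Num.Theory.
Local Open Scope ring_scope.

Definition is_kgraph (k : nat) (V : finType) (E : {set {set V}}) : Prop :=
  forall e, e \in E -> #|e| = k.

Definition deg (V : finType) (E : {set {set V}}) (S : {set V}) : nat :=
  #|[set e in E | S \subset e]|%N.

Definition mindeg_ge {R : realType} (s : nat) (V : finType)
    (E : {set {set V}}) (d : R) : Prop :=
  forall S : {set V}, #|S| = s -> d <= (deg E S)%:R.

Definition is_kpartite (k : nat) (V : finType) (E : {set {set V}}) : Prop :=
  exists c : V -> 'I_k,
    forall e, e \in E -> forall i : 'I_k, #|[set x in e | c x == i]| = 1.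

Definition npmu3 {R : realType} (n : nat) (p mu : R)
    (E : {set {set 'I_n}}) : Prop :=
  forall X1 X2 X3 : {set 'I_n},
    p * (#|X1| * #|X2| * #|X3|)%:R - mu * (n%:R ^+ 3)
      <= #|[set t : 'I_n * 'I_n * 'I_n |
              [&& t.1.1 \in X1, t.1.2 \in X2, t.2 \in X3 &
                  [set t.1.1; t.1.2; t.2] \in E]]|%:R.

Definition is_copy (f n : nat) (EF : {set {set 'I_f}}) (EH : {set {set 'I_n}})
    (g : {ffun 'I_f -> 'I_n}) : Prop :=
  injective g /\ forall e, e \in EF -> g @: e \in EH.

Definition has_factor (f n : nat) (EF : {set {set 'I_f}})
    (EH : {set {set 'I_n}}) : Prop :=
  exists C : {set {ffun 'I_f -> 'I_n}},
    (forall g, g \in C -> is_copy EF EH g) /\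
    (forall g1 g2, g1 \in C -> g2 \in C -> g1 != g2 ->
        [disjoint codom g1 & codom g2]) /\
    (forall v : 'I_n, exists2 g, g \in C & v \in codom g).

(* Main.v *)
(* Let L(x) be the link of x.  Call x and x' linked if L(x) and L(x') share a
   positive proportion of all pairs.  Linked vertices are exchangeable: the
   codegree condition extends the common link pairs to a positive density of
   triples, and by Jensen (Sidorenko's inequality for blow-ups of an edge) there
   are many tuples completing both x and x' to a copy of F.

   The bound 1/8 makes linked pairs abundant between any two linear-sized sets
   X1, X2.  Otherwise a graph G contains almost all link pairs of X1 and its
   complement almost all link pairs of X2.  Pass to pairwise G-regular clusters,
   six in X1 and three in X2.  An edge of H with its vertices in three clusters
   is a triangle whose sides are prescribed to lie in G or in its complement, so
   the product of the three corresponding densities exceeds 1/8; Ramsey's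
   R(3,3) = 6 and a count of the densities above and below 1/2 contradict this.

   The codegree condition gives every vertex linearly many linked vertices, so
   any two vertices are joined by a positive proportion of the possible paths of
   length three in the graph of linked pairs, and every f-tuple has a positive
   proportion of absorbers.  A greedy choice, controlled by the potential
   sum_Q 2^(-number of chosen absorbers of Q), picks disjoint absorbers serving
   all f-tuples linearly often; copies of F cover the rest greedily until few
   enough vertices are left to be absorbed. *)
Require Import Defs.
From HB Require Import structures.
From mathcomp Require Import all_boot all_order all_algebra.
From mathcomp Require Import reals.
From mathcomp Require Import perm ring lra zify.
Import Order.TTheory GRing.Theory Num.Theory.
Local Open Scope ring_scope.
Set Implicit Arguments.
Unset Strict Implicit.
Unset Printing Implicit Defensive.

(** * Counting blow-ups of an edge *)

(** Convexity of [x ^+ m] on the nonnegative reals, through its tangent at [d]. Multiplying one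
    tangent bound by [a] exceeds the next one by a nonnegative multiple of [(a - d) ^+ 2]. *)
Lemma expr_tangent (R : realFieldType) (a d : R) m : 0 <= a -> 0 <= d ->
  d ^+ m + m%:R * d ^+ m.-1 * (a - d) <= a ^+ m.
Proof.
move=> a0 d0; elim: m => [|m IH]; first by rewrite !expr0 mul0r mul0r addr0.
apply: le_trans (_ : a * (d ^+ m + m%:R * d ^+ m.-1 * (a - d)) <= _); last first.
  by rewrite exprS ler_wpM2l.
case: m {IH} => [|m]; first by rewrite /= expr0 expr1; lra.
rewrite /= -subr_ge0.
have -> : a * (d ^+ m.+1 + m.+1%:R * d ^+ m * (a - d)) -
    (d ^+ m.+2 + m.+2%:R * d ^+ m.+1 * (a - d)) =
    m.+1%:R * d ^+ m * (a - d) ^+ 2.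
  by rewrite !exprS -!natr1; ring.
by rewrite mulr_ge0 ?sqr_ge0 // mulr_ge0 ?exprn_ge0 ?ler0n.
Qed.

Lemma sum_cst (R : pzRingType) (X : finType) (a : R) :
  \sum_(x : X) a = a * #|X|%:R.
Proof. by rewrite sumr_const mulr_natr. Qed.

(** Jensen: when the tangent bounds at [d] are summed, the linear term is nonnegative because the
    mean of [phi] is at least [d]. *)
Lemma power_mean (R : realFieldType) (X : finType) (phi : X -> R) (d : R) m :
  (forall x, 0 <= phi x) -> 0 <= d -> d * #|X|%:R <= \sum_x phi x ->
  d ^+ m * #|X|%:R <= \sum_x phi x ^+ m.
Proof.
move=> phi0 d0 H.
apply: le_trans (_ : \sum_x (d ^+ m + m%:R * d ^+ m.-1 * (phi x - d)) <= _).
  rewrite big_split /= sum_cst lerDl -mulr_sumr.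
  rewrite mulr_ge0 ?mulr_ge0 ?exprn_ge0 ?ler0n // sumrB sum_cst.
  by rewrite subr_ge0.
by apply: ler_sum => x _; apply: expr_tangent.
Qed.

Lemma card_pairs (X T : finType) (P : X -> T -> bool) :
  #|[set u : X * T | P u.1 u.2]| = (\sum_x #|[set t | P x t]|)%N.
Proof.
rewrite -sum1dep_card.
under [RHS]eq_bigr => x _ do rewrite -sum1dep_card.
by rewrite pair_big_dep /=; apply: eq_bigl => -[x t].
Qed.

Lemma card_forall_ffun (T I : finType) (P : pred T) :
  #|[set g : {ffun I -> T} | [forall i, P (g i)]]| = (#|[set t | P t]| ^ #|I|)%N.
Proof.
rewrite -card_ffun_on cardsE; apply: eq_card => g; rewrite !inE.
by apply/forallP/ffun_onP => h i; have := h i; rewrite ?inE.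
Qed.

(** For fixed [x] the number of maps is a power of the degree of [x], so the power mean inequality
    applies to the degrees. *)
Lemma clone_density (R : realFieldType) (X T I : finType) (P : X -> T -> bool)
    (d : R) : 0 <= d ->
  d * (#|X| * #|T|)%:R <= #|[set u : X * T | P u.1 u.2]|%:R ->
  d ^+ #|I| * (#|X| * #|T| ^ #|I|)%:R <=
    #|[set u : X * {ffun I -> T} | [forall i, P u.1 (u.2 i)]]|%:R.
Proof.
move=> d0; rewrite card_pairs => H.
rewrite (card_pairs (fun x (g : {ffun I -> T}) => [forall i, P x (g i)])).
have -> : d ^+ #|I| * (#|X| * #|T| ^ #|I|)%:R =
    (d * #|T|%:R) ^+ #|I| * #|X|%:R.
  by rewrite natrM natrX exprMn; ring.
rewrite natr_sum.
under eq_bigr => x _ do rewrite (card_forall_ffun I (P x)) natrX.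
apply: (power_mean (phi := fun x => #|[set t | P x t]|%:R)) => //.
  by rewrite mulr_ge0.
by rewrite -natr_sum; apply: le_trans H; rewrite natrM; lra.
Qed.

Lemma leq_card_bij (X Y : finType) (A : {set X}) (B : {set Y}) (h : X -> Y) :
  {in A &, injective h} -> (forall x, x \in A -> h x \in B) -> (#|A| <= #|B|)%N.
Proof.
move=> hi hB; rewrite -(card_in_imset hi); apply: subset_leq_card.
by apply/subsetP => _ /imsetP[x xA ->]; apply: hB.
Qed.

(** The three coordinates are cloned in turn. Each cloning raises the density to the power [#|I|],
    whence the exponent [#|I| ^ 3]. *)
Lemma blowup_density (R : realFieldType) (T I : finType)
    (h : T -> T -> T -> bool) (d : R) : 0 <= d ->
  d * (#|T| ^ 3)%:R <= #|[set t : T * T * T | h t.1.1 t.1.2 t.2]|%:R ->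
  d ^+ (#|I| ^ 3) * (#|T| ^ (3 * #|I|))%:R <=
    #|[set u : {ffun I -> T} * {ffun I -> T} * {ffun I -> T} |
      [forall k, forall j, forall i, h (u.1.1 i) (u.1.2 j) (u.2 k)]]|%:R.
Proof.
move=> d0 H; set m := #|I|; set n := #|T|.
have H1 : d ^+ m * (#|{: T * T}| * n ^ m)%:R <=
    #|[set u : (T * T) * {ffun I -> T} | [forall i, h (u.2 i) u.1.1 u.1.2]]|%:R.
  apply: (@clone_density R (T * T)%type T I (fun x t => h t x.1 x.2)) => //.
  rewrite card_prod; apply: le_trans (le_trans H _); first by rewrite !expnS expn0 muln1 mulnA.
  rewrite ler_nat.
  (* Rotating the coordinates puts the one to be cloned next in last place. *)
  apply: (leq_card_bij (h := fun t : T * T * T => (t.1.2, t.2, t.1.1))).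
    by move=> [[a b] e] [[a' b'] e'] _ _ [-> -> ->].
  by move=> [[a b] e]; rewrite !inE.
have H2 : d ^+ m ^+ m * (#|{: T * {ffun I -> T}}| * n ^ m)%:R <=
    #|[set u : (T * {ffun I -> T}) * {ffun I -> T} |
       [forall j, forall i, h (u.1.2 i) (u.2 j) u.1.1]]|%:R.
  apply: (@clone_density R (T * {ffun I -> T})%type T I
    (fun x t => [forall i, h (x.2 i) t x.1])); first exact: exprn_ge0.
  apply: le_trans (le_trans H1 _).
    rewrite !card_prod card_ffun -/m -/n ler_wpM2l ?exprn_ge0 // ler_nat.
    by rewrite -!mulnA [(n * n ^ m)%N]mulnC.
  rewrite ler_nat.
  apply: (leq_card_bij (h := fun t : T * T * {ffun I -> T} => (t.1.2, t.2, t.1.1))).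
    by move=> [[a b] e] [[a' b'] e'] _ _ [-> -> ->].
  by move=> [[a b] e]; rewrite !inE.
have H3 : d ^+ m ^+ m ^+ m * (#|{: {ffun I -> T} * {ffun I -> T}}| * n ^ m)%:R <=
    #|[set u : ({ffun I -> T} * {ffun I -> T}) * {ffun I -> T} |
       [forall k, forall j, forall i, h (u.1.1 i) (u.1.2 j) (u.2 k)]]|%:R.
  apply: (@clone_density R ({ffun I -> T} * {ffun I -> T})%type T I
    (fun x t => [forall j, forall i, h (x.1 i) (x.2 j) t])).
    by do 2! apply: exprn_ge0.
  apply: le_trans (le_trans H2 _).
    rewrite !card_prod !card_ffun -/m -/n ler_wpM2l ?exprn_ge0 // ler_nat.
    by rewrite (mulnC (_ ^ _ * _) n)%N mulnA.
  rewrite ler_nat.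
  apply: (leq_card_bij (h := fun t : T * {ffun I -> T} * {ffun I -> T} =>
    (t.1.2, t.2, t.1.1))).
    by move=> [[a b] e] [[a' b'] e'] _ _ [-> -> ->].
  by move=> [[a b] e]; rewrite !inE.
apply: le_trans H3.
have m3 : (m ^ 3 = m * m * m)%N by rewrite !expnS expn0 muln1 mulnA.
have mm : (3 * m = m + m + m)%N by rewrite !mulSn mul0n addn0 addnA.
by rewrite -!exprM card_prod card_ffun -/m -/n -!expnD m3 mm mulnA.
Qed.

(** A homomorphism from the complete 3-partite 3-graph with classes given by [c], hence from every
    3-graph with that 3-partition. Injectivity is imposed separately. *)
Definition rainbow (T I : finType) (c : I -> 'I_3) (h : T -> T -> T -> bool)
    (g : I -> T) :=
  [forall i, forall j, forall k,
    [&& val (c i) == 0, val (c j) == 1 & val (c k) == 2]%N ==> h (g i) (g j) (g k)].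

Lemma rainbowP (T I : finType) (c : I -> 'I_3) (h : T -> T -> T -> bool)
    (g : I -> T) :
  reflect (forall i j k, val (c i) = 0%N -> val (c j) = 1%N -> val (c k) = 2%N ->
     h (g i) (g j) (g k)) (rainbow c h g).
Proof.
apply: (iffP idP) => [/forallP h1 i j k ci cj ck|h1].
  have /forallP/(_ j)/forallP/(_ k)/implyP := h1 i.
  by apply; rewrite ci cj ck.
apply/forallP => i; apply/forallP => j; apply/forallP => k.
by apply/implyP => /and3P[/eqP ? /eqP ? /eqP ?]; apply: h1.
Qed.

(** A blow-up consists of three maps, while a rainbow map uses at each index only the value that its
    class selects. The two remaining values per index account for a factor [#|T| ^ (2 * #|I|)]. *)
Lemma rainbow_density (R : realFieldType) (T I : finType) (c : I -> 'I_3)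
    (h : T -> T -> T -> bool) (d : R) : 0 <= d ->
  d * (#|T| ^ 3)%:R <= #|[set t : T * T * T | h t.1.1 t.1.2 t.2]|%:R ->
  d ^+ (#|I| ^ 3) * (#|T| ^ #|I|)%:R <=
    #|[set g : {ffun I -> T} | rainbow c h g]|%:R.
Proof.
move=> d0 H; have := blowup_density I d0 H.
set S := [set u | _]; set B := [set g | _]; set m := #|I|; set n := #|T|.
have SB : (#|S| <= #|B| * n ^ (2 * m))%N.
  have -> : (n ^ (2 * m))%N = #|{: {ffun I -> T} * {ffun I -> T}}|.
    by rewrite card_prod card_ffun mul2n -addnn expnD.
  rewrite -cardsT -cardsX.
  (* The three cyclic shifts of [sel] together retain all values of [a], [b] and [e], so the
     encoding is injective; the first shift is the rainbow map. *)
  pose sel (a b e : {ffun I -> T}) := [ffun i =>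
    match val (c i) with 0 => a i | 1 => b i | _ => e i end].
  apply: (leq_card_bij (h := fun u : {ffun I -> T} * {ffun I -> T} * {ffun I -> T} =>
     (sel u.1.1 u.1.2 u.2, (sel u.1.2 u.2 u.1.1, sel u.2 u.1.1 u.1.2)))).
    move=> [[a b] e] [[a' b'] e'] _ _ /= [/ffunP h1 /ffunP h2 /ffunP h3].
    suff : forall i, [/\ a i = a' i, b i = b' i & e i = e' i].
      move=> E; congr (_, _, _); apply/ffunP => i; by have [] := E i.
    move=> i; move: (h1 i) (h2 i) (h3 i); rewrite !ffunE.
    by case: (val (c i)) => [|[|k]].
  move=> [[a b] e]; rewrite !inE /= => /forallP hh; rewrite andbT.
  apply/rainbowP => i j k ci cj ck; rewrite /sel !ffunE ci cj ck.
  by have /forallP/(_ j)/forallP/(_ i) := hh k.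
(* Cancelling [n ^ (2 * m)] requires [n > 0]. If [n] and [m] both vanish, the empty map is the
   single rainbow map. *)
have [n0|n0] := posnP n.
  have [m0|m0] := posnP m.
    have -> : #|B| = 1%N.
      apply/eqP; rewrite eqn_leq; apply/andP; split.
        by apply: leq_trans (max_card _) _; rewrite card_ffun -/m m0.
      have [g]: exists g : {ffun I -> T}, true.
        have i0 : I -> T by move=> i; have := card0_eq m0 i; rewrite inE.
        by exists [ffun i => i0 i].
      move=> _; apply/card_gt0P; exists g; rewrite inE; apply/rainbowP => i.
      by have := card0_eq m0 i; rewrite inE.
    by rewrite m0 expn0 expr0 mul1r.
  by move=> _; rewrite n0 exp0n // mulr0 ler0n.
move=> HS; have {HS} := le_trans HS (_ : _ <= (#|B| * n ^ (2 * m))%:R).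
rewrite ler_nat => /(_ SB).
have -> : (3 * m = m + 2 * m)%N by rewrite mulSn.
by rewrite expnD !natrM mulrA ler_pM2r // ltr0n expn_gt0 n0.
Qed.

(** * Maps that are not injective or meet a given set *)

Lemma card_ffun_eq (T I : finType) (a b : I) : a != b ->
  (#|[set g : {ffun I -> T} | g a == g b]| * #|T| <= #|T| ^ #|I|)%N.
Proof.
move=> ab; rewrite -card_ffun -[#|{: {ffun I -> T}}|]cardsT -[#|T|]cardsT -cardsX.
pose up (g : {ffun I -> T}) v := [ffun i => if i == a then v else g i].
apply: (leq_card_bij (h := fun u : {ffun I -> T} * T => up u.1 u.2)) => //.
move=> [g v] [g' v']; rewrite !inE !andbT /= => /eqP e /eqP e' /ffunP E.
have vv : v = v' by have := E a; rewrite !ffunE eqxx.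
have E' i : i != a -> g i = g' i by move=> ia; have := E i; rewrite !ffunE (negbTE ia).
congr (_, _) => //; apply/ffunP => i; have [->|/E'//] := eqVneq i a.
by rewrite e e' E' // eq_sym.
Qed.

(** Exchanging the value at [a] with an arbitrary [v] is injective on pairs [(g, v)]. *)
Lemma card_ffun_in (T I : finType) (a : I) (W : {set T}) :
  (#|[set g : {ffun I -> T} | g a \in W]| * #|T| <= #|W| * #|T| ^ #|I|)%N.
Proof.
rewrite -card_ffun -[#|{: {ffun I -> T}}|]cardsT -[#|T|]cardsT -!cardsX.
pose up (g : {ffun I -> T}) v := [ffun i => if i == a then v else g i].
apply: (leq_card_bij (h := fun u : {ffun I -> T} * T => (u.1 a, up u.1 u.2))).
  move=> [g v] [g' v'] _ _ /= [ga /ffunP E].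
  have vv : v = v' by have := E a; rewrite !ffunE eqxx.
  congr (_, _) => //; apply/ffunP => i; have [->//|ia] := eqVneq i a.
  by have := E i; rewrite !ffunE (negbTE ia).
by move=> [g v]; rewrite !inE.
Qed.

Definition avoiding (T I : finType) (W : {set T}) (g : {ffun I -> T}) :=
  injectiveb g && [forall i, g i \notin W].

(** Union bound over coinciding pairs of indices and over indices sent into [W]. The factor [#|T|]
    on the left avoids an exponent [#|I| - 1]. *)
Lemma card_not_avoiding (T I : finType) (W : {set T}) :
  (#|[set g : {ffun I -> T} | ~~ avoiding W g]| * #|T| <=
    (#|I| ^ 2 + #|I| * #|W|) * #|T| ^ #|I|)%N.
Proof.
pose B1 := \bigcup_(p : I * I | p.1 != p.2) [set g : {ffun I -> T} | g p.1 == g p.2].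
pose B2 := \bigcup_(i : I) [set g : {ffun I -> T} | g i \in W].
have sub : [set g : {ffun I -> T} | ~~ avoiding W g] \subset B1 :|: B2.
  apply/subsetP => g; rewrite !inE negb_and => /orP[/injectivePn[i [j ij e]]|].
    by apply/orP; left; apply/bigcupP; exists (i, j); rewrite // inE e.
  rewrite negb_forall => /existsP[i]; rewrite negbK => gi.
  by apply/orP; right; apply/bigcupP; exists i; rewrite // inE.
have B1c : (#|B1| * #|T| <= #|I| ^ 2 * #|T| ^ #|I|)%N.
  apply: leq_trans (_ : (\sum_(p : I * I | p.1 != p.2)
    #|[set g : {ffun I -> T} | g p.1 == g p.2]|) * #|T| <= _)%N.
    rewrite leq_mul2r; apply/orP; right; rewrite /B1.
    elim/big_ind2: _ => [|x1 x2 y1 y2 h1 h2|//]; first by rewrite cards0.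
    by rewrite (leq_trans (leq_card_setU _ _)) // leq_add.
  rewrite big_distrl /=.
  apply: leq_trans (_ : \sum_(p : I * I | p.1 != p.2) #|T| ^ #|I| <= _)%N.
    by apply: leq_sum => p; apply: card_ffun_eq.
  rewrite sum_nat_const leq_mul2r; apply/orP; right.
  by apply: leq_trans (max_card _) _; rewrite card_prod !expnS expn0 muln1.
have B2c : (#|B2| * #|T| <= #|I| * #|W| * #|T| ^ #|I|)%N.
  apply: leq_trans (_ : (\sum_(i : I)
    #|[set g : {ffun I -> T} | g i \in W]|) * #|T| <= _)%N.
    rewrite leq_mul2r; apply/orP; right; rewrite /B2.
    elim/big_ind2: _ => [|x1 x2 y1 y2 h1 h2|//]; first by rewrite cards0.
    by rewrite (leq_trans (leq_card_setU _ _)) // leq_add.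
  rewrite big_distrl /=.
  apply: leq_trans (_ : \sum_(i : I) #|W| * #|T| ^ #|I| <= _)%N.
    by apply: leq_sum => p _; apply: card_ffun_in.
  by rewrite sum_nat_const mulnA.
rewrite mulnDl; apply: leq_trans (leq_add B1c B2c); rewrite -mulnDl leq_mul2r.
by rewrite (leq_trans (subset_leq_card sub)) ?leq_card_setU ?orbT.
Qed.

(** * Regular pairs of clusters *)

Definition edges (R : realFieldType) (V : finType) (G : rel V) (S T : {set V}) : R :=
  \sum_(x in S) \sum_(y in T) (G x y)%:R.

Lemma sum_cst_in (R : pzRingType) (V : finType) (S : {set V}) (a : R) :
  \sum_(x in S) a = a * #|S|%:R.
Proof. by rewrite sumr_const mulr_natr. Qed.

Lemma edges_ge0 (R : realFieldType) (V : finType) (G : rel V) (S T : {set V}) :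
  0 <= edges R G S T.
Proof. by apply: sumr_ge0 => x _; apply: sumr_ge0 => y _; apply: ler0n. Qed.

Lemma edges_le (R : realFieldType) (V : finType) (G : rel V) (S T : {set V}) :
  edges R G S T <= #|S|%:R * #|T|%:R.
Proof.
rewrite mulrC -sum_cst_in; apply: ler_sum => x _.
rewrite -[leRHS]mul1r -sum_cst_in; apply: ler_sum => y _.
by case: (G x y).
Qed.

Lemma edges_sym (R : realFieldType) (V : finType) (G : rel V) (S T : {set V}) :
  symmetric G -> edges R G S T = edges R G T S.
Proof.
move=> sG; rewrite /edges exchange_big /=; apply: eq_bigr => y _.
by apply: eq_bigr => x _; rewrite sG.
Qed.

Lemma edges_splitl (R : realFieldType) (V : finType) (G : rel V) (X S T : {set V}) :
  S \subset X -> edges R G X T = edges R G S T + edges R G (X :\: S) T.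
Proof. by move=> SX; rewrite /edges (big_setID S) /= (setIidPr SX). Qed.

Lemma edges_splitr (R : realFieldType) (V : finType) (G : rel V) (S Y T : {set V}) :
  T \subset Y -> edges R G S Y = edges R G S T + edges R G S (Y :\: T).
Proof.
move=> TY; rewrite /edges -big_split; apply: eq_bigr => x _ /=.
by rewrite (big_setID T) /= (setIidPr TY).
Qed.

Lemma card_setDR (R : realFieldType) (V : finType) (X S : {set V}) :
  S \subset X -> #|X|%:R = #|S|%:R + #|X :\: S|%:R :> R.
Proof. by move=> SX; rewrite -(cardsID S X) (setIidPr SX) natrD. Qed.

Lemma ler_card (R : realFieldType) (V : finType) (X S : {set V}) :
  S \subset X -> #|S|%:R <= #|X|%:R :> R.
Proof. by move=> SX; rewrite ler_nat subset_leq_card. Qed.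

Definition density (R : realFieldType) (V : finType) (G : rel V) (S T : {set V}) : R :=
  edges R G S T / (#|S|%:R * #|T|%:R).

(* For X or Y empty, the density is the junk value 0 and both sides vanish. *)
Lemma edges_density (R : realFieldType) (V : finType) (G : rel V) (X Y : {set V}) :
  edges R G X Y = density R G X Y * (#|X|%:R * #|Y|%:R).
Proof.
rewrite /density; have [z|nz] := eqVneq (#|X|%:R * #|Y|%:R : R) 0; last first.
  by rewrite mulfVK.
rewrite z mulr0; apply/eqP; rewrite eq_le edges_ge0 andbT -z.
exact: edges_le.
Qed.

Lemma density_ge0 (R : realFieldType) (V : finType) (G : rel V) (X Y : {set V}) :
  0 <= density R G X Y.
Proof. by rewrite divr_ge0 ?edges_ge0 ?mulr_ge0 ?ler0n. Qed.

Lemma density_le1 (R : realFieldType) (V : finType) (G : rel V) (X Y : {set V}) :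
  density R G X Y <= 1.
Proof.
rewrite /density; have [->|nz] := eqVneq (#|X|%:R * #|Y|%:R : R) 0.
  by rewrite invr0 mulr0.
rewrite ler_pdivrMr ?mul1r ?edges_le // lt_neqAle eq_sym nz.
by rewrite mulr_ge0 ?ler0n.
Qed.

(** The error is relative to the whole of [X] and [Y], as in the cut norm, so small [S] and [T] need
    not be excluded. *)
Definition regular (R : realFieldType) (V : finType) (G : rel V) (k : R)
    (X Y : {set V}) := forall S T : {set V}, S \subset X -> T \subset Y ->
  `|edges R G S T - density R G X Y * (#|S|%:R * #|T|%:R)| <= k * (#|X|%:R * #|Y|%:R).

Lemma density_sym (R : realFieldType) (V : finType) (G : rel V) (X Y : {set V}) :
  symmetric G -> density R G X Y = density R G Y X.
Proof. by move=> sG; rewrite /density (edges_sym _ _ _ sG) mulrC [RHS]mulrC [X in X^-1]mulrC. Qed.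

(* The complementary boxes cannot exceed the density either, so an upper
   deviation bound relative to the actual density is also a lower one. *)
Lemma regular_of_upper (R : realFieldType) (V : finType) (G : rel V) (k : R)
    (X Y : {set V}) :
  (forall S T : {set V}, S \subset X -> T \subset Y ->
    edges R G S T <= density R G X Y * (#|S|%:R * #|T|%:R) + k * (#|X|%:R * #|Y|%:R)) ->
  0 <= k -> regular G (2 * k) X Y.
Proof.
move=> up k0 S T SX TY; rewrite ler_norml.
have XY0 : 0 <= k * (#|X|%:R * #|Y|%:R) by rewrite mulr_ge0 ?mulr_ge0 ?ler0n.
have u1 := up S T SX TY.
have u2 := up S (Y :\: T) SX (subsetDl _ _).
have u3 := up (X :\: S) Y (subsetDl _ _) (subxx _).
have eq := edges_density R G X Y.
rewrite (edges_splitl _ _ _ SX) (edges_splitr _ _ _ TY) in eq.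
rewrite -[2 * k * _]mulrA.
set d := density R G X Y in u1 u2 u3 eq *.
set K := k * _ in XY0 u1 u2 u3 *.
have dE : d * (#|X|%:R * #|Y|%:R) = d * (#|S|%:R * #|T|%:R) +
    d * (#|S|%:R * #|Y :\: T|%:R) + d * (#|X :\: S|%:R * #|Y|%:R).
  by rewrite (card_setDR R SX) (card_setDR R TY); ring.
by rewrite dE in eq; apply/andP; split; lra.
Qed.

(** Density increment: while some box exceeds the current density by an error [q], pass to that box.
    The density grows by [q] each time, so the number of rounds, and with it the loss in size, is
    bounded in terms of [k] alone. *)
Lemma regular_pair (R : archiRealFieldType) (k : R) : 0 < k ->
  exists s : R, [/\ 0 < s, s <= 1 &
  forall (V : finType) (G : rel V) (X Y : {set V}),
  exists X' Y' : {set V}, [/\ X' \subset X, Y' \subset Y,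
    s * #|X|%:R <= #|X'|%:R, s * #|Y|%:R <= #|Y'|%:R & regular G k X' Y']].
Proof.
move=> k0; pose q := Num.min (k / 2) 1.
have q0 : 0 < q by rewrite lt_min ltr01 andbT divr_gt0 ?ltr0n.
have q1 : q <= 1 by rewrite /q ge_min lexx orbT.
have qk : 2 * q <= k.
  have h : q <= k / 2 by rewrite /q ge_min lexx.
  by rewrite mulrC -ler_pdivlMr ?ltr0n.
(* The density is at least [1 - j * q], so at most [j] increments remain. *)
have iter j : forall (V : finType) (G : rel V) (X Y : {set V}),
    (1 - j%:R * q) * (#|X|%:R * #|Y|%:R) <= edges R G X Y ->
  exists X' Y' : {set V}, [/\ X' \subset X, Y' \subset Y,
    q ^+ j * #|X|%:R <= #|X'|%:R, q ^+ j * #|Y|%:R <= #|Y'|%:R & regular G k X' Y'].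
  elim: j => [|j IH] V G X Y H.
    exists X, Y; split; rewrite ?subxx ?expr0 ?mul1r //.
    move=> S T SX TY.
    apply: le_trans (_ : 2 * q * (#|X|%:R * #|Y|%:R) <= _); last first.
      by rewrite ler_wpM2r ?mulr_ge0.
    apply: regular_of_upper; rewrite ?ltW // => {S SX T TY} S T SX TY.
    have := edges_le R G S T; have := edges_density R G X Y.
    have := ler_card R SX; have := ler_card R TY.
    move: H; rewrite mul0r subr0 mul1r.
    have X0 : 0 <= #|X|%:R :> R by []. have Y0 : 0 <= #|Y|%:R :> R by [].
    have S0 : 0 <= #|S|%:R :> R by []. have T0 : 0 <= #|T|%:R :> R by [].
    have d0 := density_ge0 R G X Y; have d1 := density_le1 R G X Y.
    have XY0 : 0 <= #|X|%:R * #|Y|%:R :> R by rewrite mulr_ge0.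
    move=> H TY' SX' e1 e2.
    (* For an empty side the density is 0 rather than 1, and all terms vanish. *)
    have [z|nz] := eqVneq (#|X|%:R * #|Y|%:R : R) 0.
      have : #|S|%:R * #|T|%:R <= #|X|%:R * #|Y|%:R :> R by rewrite ler_pM.
      have ST0 : 0 <= #|S|%:R * #|T|%:R :> R by rewrite mulr_ge0.
      rewrite z => ST1.
      have -> : (#|S|%:R * #|T|%:R : R) = 0 by apply/eqP; rewrite eq_le ST1.
      by move: e2; rewrite mulr0 mulr0 addr0; lra.
    have XYp : 0 < #|X|%:R * #|Y|%:R :> R by rewrite lt_neqAle eq_sym nz.
    have -> : density R G X Y = 1.
      apply/eqP; rewrite eq_le d1 /=.
      by rewrite -(ler_pM2r XYp) mul1r -e1.
    rewrite mul1r; apply: le_trans e2 _; rewrite lerDl mulr_ge0 // ltW //.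
  have qj : q ^+ j.+1 <= 1 by rewrite exprn_ile1 // ltW.
  have [|/existsPn up] := boolP [exists p : {set V} * {set V},
    [&& p.1 \subset X, p.2 \subset Y &
      density R G X Y * (#|p.1|%:R * #|p.2|%:R) + q * (#|X|%:R * #|Y|%:R)
        < edges R G p.1 p.2]]; last first.
    exists X, Y; split; rewrite ?subxx ?ler_piMl //.
    move=> S T SX TY.
    apply: le_trans (_ : 2 * q * (#|X|%:R * #|Y|%:R) <= _); last first.
      by rewrite ler_wpM2r ?mulr_ge0.
    apply: regular_of_upper; rewrite ?ltW // => {S SX T TY} S T SX TY.
    by have := up (S, T); rewrite /= SX TY /= -leNgt.
  move=> /existsP[[S T] /= /and3P[SX TY lt]].
  have e1 := edges_le R G S T; have e2 := edges_density R G X Y.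
  have sX := ler_card R SX; have tY := ler_card R TY.
  have d0 := density_ge0 R G X Y; have d1 := density_le1 R G X Y.
  have X0 : 0 <= #|X|%:R :> R by []. have Y0 : 0 <= #|Y|%:R :> R by [].
  have S0 : 0 <= #|S|%:R :> R by []. have T0 : 0 <= #|T|%:R :> R by [].
  set d := density R G X Y in lt e2 d0 d1 *.
  move: H lt e1 e2 sX tY X0 Y0 S0 T0; rewrite -natr1.
  set x := #|X|%:R; set y := #|Y|%:R; set u := #|S|%:R; set t := #|T|%:R.
  move=> H lt e1 e2 sX tY X0 Y0 S0 T0.
  have ut0 : 0 <= u * t by rewrite mulr_ge0.
  have dut0 : 0 <= d * (u * t) by rewrite mulr_ge0.
  (* The excess of at least [q * (x * y)] edges must fit into the box, so each side of the box keeps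
     a proportion [q]. *)
  have qut : q * (x * y) < u * t by lra.
  have yp : 0 < y.
    rewrite lt_neqAle Y0 andbT; apply/eqP => y0; move: qut tY; rewrite -y0 => qut tY.
    have tz : t = 0 by lra.
    by move: qut; rewrite tz !mulr0 ltxx.
  have xp : 0 < x.
    rewrite lt_neqAle X0 andbT; apply/eqP => x0; move: qut sX; rewrite -x0 => qut sX.
    have tz : u = 0 by lra.
    by move: qut; rewrite tz !mul0r mulr0 ltxx.
  have xyp : 0 < x * y by rewrite mulr_gt0.
  have uq : q * x <= u.
    have : q * (x * y) <= u * y by apply: le_trans (ltW qut) _; rewrite ler_wpM2l.
    by rewrite mulrA ler_pM2r.
  have tq : q * y <= t.
    have : q * (x * y) <= x * t by apply: le_trans (ltW qut) _; rewrite ler_wpM2r.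
    by rewrite mulrCA ler_pM2l.
  have dj : 1 - (j%:R + 1) * q <= d.
    by rewrite -(ler_pM2r xyp) -e2.
  have [X' [Y' [X'S Y'T X'q Y'q reg]]] : exists X' Y' : {set V},
      [/\ X' \subset S, Y' \subset T,
        q ^+ j * #|S|%:R <= #|X'|%:R, q ^+ j * #|T|%:R <= #|Y'|%:R & regular G k X' Y'].
    apply: IH; rewrite -/u -/t; apply: le_trans (ltW lt).
    apply: le_trans (_ : (d + q) * (u * t) <= _).
      by rewrite ler_wpM2r //; lra.
    by rewrite mulrDl lerD2l ler_wpM2l ?(ltW q0) // ler_pM.
  have qj0 : 0 <= q ^+ j by rewrite exprn_ge0 // ltW.
  exists X', Y'; split => //.
  - exact: subset_trans X'S SX.
  - exact: subset_trans Y'T TY.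
  - by apply: le_trans X'q; rewrite exprSr -mulrA ler_wpM2l.
  - by apply: le_trans Y'q; rewrite exprSr -mulrA ler_wpM2l.
(* For this [j] the starting hypothesis of [iter] is void. *)
have [j jq] : exists j : nat, 1 <= j%:R * q.
  exists (Num.bound q^-1); rewrite -ler_pdivrMr // div1r.
  by apply: ltW; apply: archi_boundP; rewrite invr_ge0 ltW.
exists (q ^+ j); split; first by rewrite exprn_gt0.
  by rewrite exprn_ile1 // ltW.
move=> V G X Y; apply: iter; apply: le_trans (edges_ge0 _ _ _ _).
by rewrite mulr_le0_ge0 ?mulr_ge0 // subr_le0.
Qed.

(** The old error is used twice, once for the box and once for the change of density, and is
    rescaled by [s ^+ 2] to the smaller product of sizes. *)
Lemma regular_sub (R : realFieldType) (V : finType) (G : rel V) (k s : R)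
    (X Y X' Y' : {set V}) : 0 <= k -> 0 < s -> X' \subset X -> Y' \subset Y ->
  s * #|X|%:R <= #|X'|%:R -> s * #|Y|%:R <= #|Y'|%:R ->
  regular G k X Y -> regular G (2 * k / s ^+ 2) X' Y'.
Proof.
move=> k0 s0 XX YY sX sY reg S T SX TY.
have r1 := reg S T (subset_trans SX XX) (subset_trans TY YY).
have := reg X' Y' XX YY; rewrite [edges R G X' Y']edges_density.
have tY := ler_card R TY; have tX := ler_card R SX.
have X0 : 0 <= #|X|%:R :> R by []. have Y0 : 0 <= #|Y|%:R :> R by [].
have S0 : 0 <= #|S|%:R :> R by []. have T0 : 0 <= #|T|%:R :> R by [].
move: r1 sX sY tX tY X0 Y0 S0 T0; set d := density _ _ _ _; set d' := density _ _ _ _.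
set x := #|X|%:R; set y := #|Y|%:R; set u := #|S|%:R; set t := #|T|%:R.
set x' := #|X'|%:R; set y' := #|Y'|%:R; set e := edges _ _ _ _.
move=> r1 sX sY tX tY X0 Y0 S0 T0 r2.
have st : u * t <= x' * y' by rewrite ler_pM.
have ut0 : 0 <= u * t by rewrite mulr_ge0.
have xy' : 0 <= x' * y' by lra.
have le1 : k * (x * y) <= k / s ^+ 2 * (x' * y').
  rewrite mulrAC ler_pdivlMr ?exprn_gt0 // -mulrA ler_wpM2l //.
  rewrite (_ : x * y * s ^+ 2 = (s * x) * (s * y)); last by ring.
  by rewrite ler_pM // mulr_ge0 // (ltW s0).
have le2 : `|d' - d| * (u * t) <= k * (x * y).
  apply: le_trans r2; rewrite -mulrBl normrM (ger0_norm xy').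
  by rewrite ler_wpM2l.
rewrite (_ : e - _ = (e - d * (u * t)) - (d' - d) * (u * t)); last by ring.
apply: le_trans (ler_normB _ _) _; rewrite normrM (ger0_norm ut0).
by rewrite (_ : 2 * k / s ^+ 2 * (x' * y') = 2 * (k / s ^+ 2 * (x' * y'))); lra.
Qed.

Lemma regular_le (R : realFieldType) (V : finType) (G : rel V) (k k' : R)
    (X Y : {set V}) : k <= k' -> regular G k X Y -> regular G k' X Y.
Proof.
move=> kk reg S T SX TY; apply: le_trans (reg S T SX TY) _.
by rewrite ler_wpM2r ?mulr_ge0.
Qed.

(** The pairs are regularised one after another. Only finitely many prescribed pairs occur, so no
    partition of the whole vertex set is needed, and [s] is uniform in [V]. *)
Lemma regular_family (R : archiRealFieldType) (N : finType) (ps : seq (N * N)) (k : R) :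
  0 < k -> all (fun p => p.1 != p.2) ps ->
  exists s : R, [/\ 0 < s, s <= 1 &
  forall (V : finType) (G : rel V) (U : N -> {set V}),
  exists U' : N -> {set V},
    (forall i, U' i \subset U i /\ s * #|U i|%:R <= #|U' i|%:R) /\
    (forall p, p \in ps -> regular G k (U' p.1) (U' p.2))].
Proof.
move=> k0; elim: ps => [|[a b] ps IH] /=.
  move=> _; exists 1; split=> // V G U; exists U; split => // i.
  by rewrite subxx mul1r.
move=> /andP[/= ab /IH[s [s0 s1 H]]].
(* The later pairs shrink each cluster by at most the factor [s], which by [regular_sub] turns this
   error into [k]. *)
have k2 : 0 < k * s ^+ 2 / 2 by rewrite divr_gt0 ?mulr_gt0 ?exprn_gt0.
have [q [q0 q1 Hq]] := regular_pair k2.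
exists (s * q); split; first by rewrite mulr_gt0.
  by rewrite mulr_ile1 // ltW.
move=> V G U; have [A [B [AU BU Aq Bq reg]]] := Hq V G (U a) (U b).
pose W i := if i == a then A else if i == b then B else U i.
have [U' [U1 U2]] := H V G W.
have Wa : W a = A by rewrite /W eqxx.
have Wb : W b = B by rewrite /W eq_sym (negbTE ab) eqxx.
have WU i : W i \subset U i /\ q * #|U i|%:R <= #|W i|%:R.
  rewrite /W; case: eqP => [->|_] //; case: eqP => [->|_] //.
  by rewrite subxx ler_piMl.
exists U'; split.
  move=> i; have [h1 h2] := U1 i; have [h3 h4] := WU i; split.
    exact: subset_trans h1 h3.
  by apply: le_trans h2; rewrite -mulrA ler_wpM2l // ltW.
move=> p; rewrite inE => /orP[/eqP->/=|]; last exact: U2.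
have [h1 h2] := U1 a; have [h3 h4] := U1 b.
rewrite Wa in h1 h2; rewrite Wb in h3 h4.
have := regular_sub (ltW k2) s0 h1 h3 h2 h4 reg; apply: regular_le.
rewrite (_ : 2 * (k * s ^+ 2 / 2) / s ^+ 2 = k) //.
by field; rewrite gt_eqF.
Qed.

(** * Triangles in regular triples *)

(** A vertex has three neighbours or three non-neighbours. A related pair among the neighbours
    closes a triangle; non-neighbours are pairwise related, since otherwise two of them and the
    vertex form an empty triple. *)
Lemma ramsey33 (T : finType) (r : rel T) : symmetric r -> (6 <= #|T|)%N ->
  (forall x y z, x != y -> y != z -> z != x -> [|| r x y, r x z | r y z]) ->
  exists x y z, [/\ x != y, y != z & z != x] /\ [/\ r x y, r x z & r y z].
Proof.
move=> sr T6 H; have /card_gt0P[x0 _] : (0 < #|T|)%N by exact: leq_trans T6.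
pose A := [set y | (y != x0) && r x0 y]; pose B := [set y | (y != x0) && ~~ r x0 y].
have AB : (#|A| + #|B| = #|T|.-1)%N.
  rewrite -(cardC1 x0) -(cardID (r x0) (predC1 x0)); congr (_ + _)%N; rewrite cardsE;
  by apply: eq_card => y; rewrite !inE /in_mem /=; case: eqP; case: (r x0 y).
have [A3|A3] := leqP 3 #|A|.
  have [x [y [z [[]]]]] := card_gt2P A3.
  rewrite !inE => /andP[xx rx] /andP[yx ry] /andP[zx rz] [xy yz zx'].
  case/or3P: (H _ _ _ xy yz zx') => rr.
  - by exists x0, x, y; split; split => //; rewrite eq_sym.
  - by exists x0, x, z; split; split => //; rewrite eq_sym.
  - by exists x0, y, z; split; split => //; rewrite eq_sym.
have B3 : (3 <= #|B|)%N by lia.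
have [x [y [z [[]]]]] := card_gt2P B3.
rewrite !inE => /andP[xx rx] /andP[yx ry] /andP[zx rz] [xy yz zx'].
have nr u v : u != x0 -> v != x0 -> u != v -> ~~ r x0 u -> ~~ r x0 v -> r u v.
  move=> ux vx uv ru rv; have := H x0 u v; rewrite eq_sym ux uv vx (negbTE ru) (negbTE rv).
  by apply.
by exists x, y, z; split; split=> //; apply: nr => //; rewrite eq_sym.
Qed.

Definition upper (R : realFieldType) (V : finType) (G : rel V) (k d : R)
    (X Y : {set V}) := forall S T : {set V}, S \subset X -> T \subset Y ->
  edges R G S T <= d * (#|S|%:R * #|T|%:R) + k * (#|X|%:R * #|Y|%:R).

Definition triples (R : realFieldType) (V : finType) (h : V -> V -> V -> bool)
    (X Y Z : {set V}) : R := \sum_(x in X) \sum_(y in Y) \sum_(z in Z) (h x y z)%:R.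

Lemma sum_setI (R : realFieldType) (V : finType) (X : {set V}) (P : pred V) (F : V -> R) :
  \sum_(x in X) (P x)%:R * F x = \sum_(x in [set x in X | P x]) F x.
Proof.
rewrite big_mkcond [RHS]big_mkcond; apply: eq_bigr => x _; rewrite inE.
by case: (x \in X); case: (P x) => //=; rewrite ?mul1r ?mul0r.
Qed.

(** For fixed [z] the pairs [(x, y)] range over a box, to which the bound for [f] applies. Summing
    the box sizes over [z] counts [l]-edges between [Y] and the [g]-neighbourhoods of the vertices
    [x]; the bounds for [l] and then [g] finish. *)
Lemma triangles_upper (R : realFieldType) (V : finType) (f g l : rel V)
    (k a b d : R) (X Y Z : {set V}) : 0 <= k -> 0 <= a <= 1 -> 0 <= b <= 1 ->
  0 <= d <= 1 -> upper f k a X Y -> upper g k b X Z -> upper l k d Y Z ->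
  triples R (fun x y z => [&& f x y, g x z & l y z]) X Y Z <=
    (a * b * d + 3 * k) * (#|X|%:R * #|Y|%:R * #|Z|%:R).
Proof.
move=> k0 /andP[a0 a1] /andP[b0 b1] /andP[d0 d1] uf ug ul.
pose S z := [set x in X | g x z]; pose T z := [set y in Y | l y z].
have SX z : S z \subset X by apply/subsetP => x; rewrite inE => /andP[].
have TY z : T z \subset Y by apply/subsetP => x; rewrite inE => /andP[].
have -> : triples R (fun x y z => [&& f x y, g x z & l y z]) X Y Z =
    \sum_(z in Z) edges R f (S z) (T z).
  rewrite /triples; under eq_bigr => x _ do rewrite exchange_big /=.
  rewrite exchange_big /=; apply: eq_bigr => z _.
  rewrite /edges -sum_setI; apply: eq_bigr => x _.
  rewrite -sum_setI mulr_sumr; apply: eq_bigr => y _.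
  by case: (f x y); case: (g x z); case: (l y z); rewrite /= ?mul0r ?mul1r ?mulr0.
apply: le_trans (_ : \sum_(z in Z) (a * (#|S z|%:R * #|T z|%:R) +
     k * (#|X|%:R * #|Y|%:R)) <= _).
  by apply: ler_sum => z _; apply: uf.
rewrite big_split /= sum_cst_in -mulr_sumr.
have -> : \sum_(z in Z) #|S z|%:R * #|T z|%:R =
    \sum_(x in X) edges R l Y [set z in Z | g x z].
  under eq_bigr => z _ do rewrite mulrC -sum_cst_in -sum_setI.
  rewrite exchange_big /=; apply: eq_bigr => x _; rewrite sum_setI /edges.
  rewrite exchange_big /=; apply: eq_bigr => z _.
  rewrite -[LHS]mul1r -sum_cst_in -sum_setI; apply: eq_bigr => y _.
  by rewrite mulr1.
have h1 : \sum_(x in X) edges R l Y [set z in Z | g x z] <=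
    d * (#|Y|%:R * edges R g X Z) + k * (#|X|%:R * #|Y|%:R * #|Z|%:R).
  apply: le_trans (_ : \sum_(x in X) (d * (#|Y|%:R * #|[set z in Z | g x z]|%:R) +
     k * (#|Y|%:R * #|Z|%:R)) <= _).
    apply: ler_sum => x _; apply: ul => //.
    by apply/subsetP => z; rewrite inE => /andP[].
  rewrite big_split /= sum_cst_in -mulr_sumr -mulr_sumr.
  rewrite (_ : \sum_(x in X) #|_|%:R = edges R g X Z); last first.
    apply: eq_bigr => x _; rewrite -[LHS]mul1r -sum_cst_in -sum_setI.
    by apply: eq_bigr => z _; rewrite mulr1.
  rewrite lerD2l le_eqVlt; apply/orP; left; apply/eqP; ring.
have h2 := ug X Z (subxx _) (subxx _).
move: h1 h2; set x := #|X|%:R; set y := #|Y|%:R; set z := #|Z|%:R.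
have x0 : 0 <= x by []. have y0 : 0 <= y by []. have z0 : 0 <= z by [].
move: (edges R g X Z) => e; set s := \sum_(_ in _) _ => h1 h2.
have xz0 : 0 <= x * z by rewrite mulr_ge0.
have xyz0 : 0 <= k * (x * y * z) by rewrite !mulr_ge0.
apply: le_trans (_ : a * (d * (y * (b * (x * z) + k * (x * z))) + k * (x * y * z)) +
   k * (x * y) * z <= _).
  rewrite lerD2r ler_wpM2l //; apply: le_trans h1 _.
  by rewrite lerD2r ler_wpM2l // ler_wpM2l.
(* The three error terms have coefficients [a * d], [a] and 1, at most 3 in total. *)
rewrite (_ : a * _ + _ = a * b * d * (x * y * z) + (a * d + a + 1) * (k * (x * y * z)));
  last by ring.
rewrite [leRHS]mulrDl lerD2l -[3 * k * _]mulrA ler_wpM2r //.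
have : a * d <= 1 by rewrite mulr_ile1.
lra.
Qed.

(** * The threshold 1/8 and common links of two large sets *)

Definition side (V : finType) (b : bool) (G : rel V) : rel V :=
  fun x y => if b then G x y else ~~ G x y.

Definition sideD (R : realFieldType) (b : bool) (d : R) := if b then d else 1 - d.

Lemma upper_side (R : realFieldType) (V : finType) (G : rel V) (k : R) b (X Y : {set V}) :
  regular G k X Y -> upper (side b G) k (sideD b (density R G X Y)) X Y.
Proof.
move=> reg S T SX TY; have := reg S T SX TY; rewrite ler_norml => /andP[h1 h2].
case: b; rewrite /side /sideD; first by rewrite -/(edges R G S T); lra.
have -> : edges R (fun x y => ~~ G x y) S T = #|S|%:R * #|T|%:R - edges R G S T.
  apply/eqP; rewrite eq_sym subr_eq /edges -big_split /= mulrC -sum_cst_in.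
  apply/eqP; apply: eq_bigr => x _.
  rewrite -big_split /= -[LHS]mul1r -sum_cst_in; apply: eq_bigr => y _.
  by case: (G x y); rewrite ?add0r ?addr0.
lra.
Qed.

Lemma sideD_bound (R : realFieldType) (V : finType) (G : rel V) b (X Y : {set V}) :
  0 <= sideD b (density R G X Y) <= 1.
Proof.
have := density_ge0 R G X Y; have := density_le1 R G X Y.
by case: b; rewrite /sideD => h1 h2; apply/andP; split; lra.
Qed.

Lemma mul_le_eighth (R : realFieldType) (a b d : R) : 0 <= a <= 1 / 2 ->
  0 <= b <= 1 / 2 -> 0 <= d <= 1 / 2 -> a * b * d <= 1 / 8.
Proof.
move=> /andP[a0 a1] /andP[b0 b1] /andP[d0 d1].
have -> : 1 / 8 = 1 / 2 * (1 / 2) * (1 / 2) :> R by field.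
by rewrite ler_pM ?mulr_ge0 // ler_pM.
Qed.

(* 'I_6 indexes the clusters inside X1 and 'I_3 those inside X2.  Three of the
   six have pairwise densities above 1/2, and two of the three have density
   below 1/2.  Among the six mixed densities, at least three are then below 1/2
   (one for each of the three) but at most two are (one for each of the two). *)
Lemma no_density_pattern (R : realFieldType) (d : 'I_6 + 'I_3 -> 'I_6 + 'I_3 -> R) :
  (forall i j, d i j = d j i) -> (forall i j, 0 <= d i j <= 1) ->
  (forall i j k, i != j -> j != k -> k != i -> 1 / 8 <
    sideD (is_inl i) (d j k) * sideD (is_inl j) (d i k) * sideD (is_inl k) (d i j)) ->
  False.
Proof.
move=> sd bd H.
(* Three clusters of [X1] with all densities at most 1/2 would give a product of at most 1/8, so the
   relation [r] has no empty triple. *)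
pose r (i j : 'I_6) := 1 / 2 < d (inl i) (inl j).
have [i1 [i2 [i3 [[n12 n23 n31] [r12 r13 r23]]]]] : exists x y z,
    [/\ x != y, y != z & z != x] /\ [/\ r x y, r x z & r y z].
  apply: ramsey33; [by move=> i j; rewrite /r sd | by rewrite card_ord |].
  move=> x y z xy yz zx; rewrite /r !ltNge -!negb_and; apply/negP => /and3P[h1 h2 h3].
  have := H (inl x) (inl y) (inl z) xy yz zx; rewrite /sideD /= ltNge.
  apply/negP; rewrite negbK; apply: mul_le_eighth; apply/andP; split=> //;
  by have /andP[] := bd (inl x) (inl y); have /andP[] := bd (inl x) (inl z);
    have /andP[] := bd (inl y) (inl z).
have [j1 [j2 [m12 s12]]] : exists j1 j2 : 'I_3, j1 != j2 /\ d (inr j1) (inr j2) < 1 / 2.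
  pose a : 'I_3 := ord0; pose b : 'I_3 := lift ord0 ord0; pose c : 'I_3 := ord_max.
  have [h1|h1] := ltP (d (inr a) (inr b)) (1 / 2); first by exists a, b.
  have [h2|h2] := ltP (d (inr a) (inr c)) (1 / 2); first by exists a, c.
  have [h3|h3] := ltP (d (inr b) (inr c)) (1 / 2); first by exists b, c.
  have := H (inr a) (inr b) (inr c) erefl erefl erefl; rewrite /sideD /= ltNge.
  have e1 := bd (inr a) (inr b); have e2 := bd (inr a) (inr c).
  have e3 := bd (inr b) (inr c).
  case/negP; apply: mul_le_eighth; apply/andP; split; lra.
(* The pair of clusters in [X1] lies opposite a vertex in [X2] and so contributes [1 - d], which is
   below 1/2; the two mixed densities cannot both be at most 1/2 as well. *)
have P i i' j : i != i' -> r i i' -> ~ (d (inl i) (inr j) <= 1 / 2 /\ d (inl i') (inr j) <= 1 / 2).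
  move=> ii rii [h1 h2]; have := H (inl i) (inl i') (inr j) ii erefl erefl.
  rewrite /sideD /= ltNge => /negP; apply.
  have := bd (inl i) (inr j); have := bd (inl i') (inr j); have := bd (inl i) (inl i').
  move: rii; rewrite /r => e0 e1 e2 e3.
  by apply: mul_le_eighth; apply/andP; split; lra.
have Q i : ~ (1 / 2 <= d (inl i) (inr j1) /\ 1 / 2 <= d (inl i) (inr j2)).
  move=> [h1 h2]; have := H (inl i) (inr j1) (inr j2) erefl m12 erefl.
  rewrite /sideD /= ltNge => /negP; apply.
  have := bd (inl i) (inr j1); have := bd (inl i) (inr j2); have := bd (inr j1) (inr j2).
  move=> e1 e2 e3.
  by apply: mul_le_eighth; apply/andP; split; lra.
have Q' i : d (inl i) (inr j1) < 1 / 2 \/ d (inl i) (inr j2) < 1 / 2.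
  case: (ltP (d (inl i) (inr j1)) (1 / 2)) => [|h1]; first by left.
  by case: (ltP (d (inl i) (inr j2)) (1 / 2)) => [|h2]; [right | case: (Q i)].
have n13 : i1 != i3 by rewrite eq_sym.
(* Pigeonhole: two of the three clusters in [X1] have small density to the same [j], against [P]. *)
case: (Q' i1) => /ltW a1; case: (Q' i2) => /ltW a2; case: (Q' i3) => /ltW a3.
- exact: (P i1 i2 j1).
- exact: (P i1 i2 j1).
- exact: (P i1 i3 j1).
- exact: (P i2 i3 j2).
- exact: (P i2 i3 j1).
- exact: (P i1 i3 j2).
- exact: (P i1 i2 j2).
- exact: (P i1 i2 j2).
Qed.

Definition symmetric3 (V : Type) (h : V -> V -> V -> bool) :=
  (forall x y z, h x y z = h y x z) /\ (forall x y z, h x y z = h x z y).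

Lemma triples_swap12 (R : realFieldType) (V : finType) (h : V -> V -> V -> bool) (X Y Z : {set V}) :
  triples R h X Y Z = triples R (fun y x z => h x y z) Y X Z.
Proof. by rewrite /triples exchange_big. Qed.

Lemma triples_swap23 (R : realFieldType) (V : finType) (h : V -> V -> V -> bool) (X Y Z : {set V}) :
  triples R h X Y Z = triples R (fun x z y => h x y z) X Z Y.
Proof. by apply: eq_bigr => x _; rewrite exchange_big. Qed.

Lemma triples_le (R : realFieldType) (V : finType) (h h' : V -> V -> V -> bool) (X Y Z : {set V}) :
  (forall x y z, h x y z -> h' x y z) -> triples R h X Y Z <= triples R h' X Y Z.
Proof.
move=> hh; apply: ler_sum => x _; apply: ler_sum => y _; apply: ler_sum => z _.
by rewrite ler_nat leq_b1 || (case E: (h x y z); rewrite ?(hh _ _ _ E)).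
Qed.

Lemma triplesD (R : realFieldType) (V : finType) (h h1 h2 : V -> V -> V -> bool) (X Y Z : {set V}) :
  (forall x y z, h x y z -> h1 x y z || h2 x y z) ->
  triples R h X Y Z <= triples R h1 X Y Z + triples R h2 X Y Z.
Proof.
move=> hh; rewrite /triples -big_split; apply: ler_sum => x _.
rewrite -big_split; apply: ler_sum => y _; rewrite -big_split; apply: ler_sum => z _ /=.
rewrite -natrD ler_nat; have := hh x y z.
by case: (h x y z) => // /(_ isT); case: (h1 x y z); case: (h2 x y z).
Qed.

(* Up to t triples, the links of the vertices of X lie in one side of G. *)
Definition links_in (R : realFieldType) (V : finType) (h : V -> V -> V -> bool)
    (G : rel V) (t : R) (b : bool) (X : {set V}) := forall Y Z : {set V},
  triples R (fun x y z => h x y z && ~~ side b G y z) X Y Z <= t.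

(** Apart from at most [t] exceptions for each cluster, an edge is a triangle in which the pair
    opposite a vertex lies on the side belonging to the cluster of that vertex. Regularity bounds
    the number of such triangles. *)
Lemma box_density (R : realFieldType) (V : finType) (h : V -> V -> V -> bool)
    (G : rel V) (p m k t : R) (X Y Z : {set V}) (bX bY bZ : bool) :
  symmetric3 h -> 0 <= k ->
  p * (#|X|%:R * #|Y|%:R * #|Z|%:R) - m <= triples R h X Y Z ->
  links_in h G t bX X -> links_in h G t bY Y -> links_in h G t bZ Z ->
  regular G k Y Z -> regular G k X Z -> regular G k X Y ->
  p * (#|X|%:R * #|Y|%:R * #|Z|%:R) <=
    (sideD bX (density R G Y Z) * sideD bY (density R G X Z) * sideD bZ (density R G X Y)
      + 3 * k) * (#|X|%:R * #|Y|%:R * #|Z|%:R) + (m + 3 * t).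
Proof.
move=> [h12 h23] k0 lo lX lY lZ rYZ rXZ rXY.
have := triangles_upper k0 (sideD_bound R G bZ X Y) (sideD_bound R G bY X Z)
  (sideD_bound R G bX Y Z) (upper_side bZ rXY) (upper_side bY rXZ)
  (upper_side bX rYZ).
set T := triples _ _ _ _ _ => T_le.
have {}lX := lX Y Z; have {}lY := lY X Z; have {}lZ := lZ X Y.
rewrite triples_swap12 in lY; rewrite triples_swap12 triples_swap23 in lZ.
set TX := triples _ _ _ _ _ in lX; set TY := triples _ _ _ _ _ in lY.
set TZ := triples _ _ _ _ _ in lZ.
have : triples R h X Y Z <= T + (TX + (TY + TZ)).
  pose hX x y z := h x y z && ~~ side bX G y z.
  pose hY x y z := h y x z && ~~ side bY G x z.
  pose hZ x y z := h z x y && ~~ side bZ G x y.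
  pose hT x y z := [&& side bZ G x y, side bY G x z & side bX G y z].
  have hh x y z : h x y z -> hT x y z || (hX x y z || (hY x y z || hZ x y z)).
    move=> hxyz; rewrite /hX /hY /hZ /hT.
    rewrite -(h12 x y z) -(h12 x z y) -(h23 x y z) hxyz /=.
    by case: (side bX G y z); case: (side bY G x z); case: (side bZ G x y).
  apply: le_trans (triplesD R X Y Z hh) _; rewrite lerD2l.
  apply: le_trans (triplesD R X Y Z (h1 := hX) (h2 := fun x y z => hY x y z || hZ x y z) _) _.
    by [].
  by rewrite lerD2l; apply: triplesD.
lra.
Qed.

Lemma triples_pairs (R : realFieldType) (V : finType) (h : V -> V -> V -> bool)
    (G : rel V) (A X Y Z : {set V}) : X \subset A ->
  triples R (fun x y z => h x y z && G y z) X Y Z <=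
    \sum_y \sum_z (G y z)%:R * \sum_(x in A) (h x y z)%:R.
Proof.
move=> XA; rewrite triples_swap12 triples_swap23 /triples big_mkcond /=.
apply: ler_sum => y _; case: ifP => _; last first.
  by apply: sumr_ge0 => z _; rewrite mulr_ge0 // sumr_ge0.
rewrite big_mkcond; apply: ler_sum => z _ /=; case: ifP => _; last first.
  by rewrite mulr_ge0 // sumr_ge0.
rewrite mulr_sumr big_mkcond [leRHS]big_mkcond; apply: ler_sum => x _.
have := subsetP XA x; case: (x \in X) => [->//|_].
  by case: (h x y z); case: (G y z); rewrite /= ?mul1r ?mul0r ?mulr0.
by case: (x \in A); rewrite ?mulr_ge0.
Qed.

(** The sum counts common link pairs of [x] in [X1] and [x'] in [X2]. If it is small, the pairs of
    large degree into [X1] form a graph holding nearly all link pairs of [X1] and, by Markov's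
    inequality, few of [X2]; regular clusters then realise the excluded pattern of densities. *)
Lemma robust_link (R : archiRealFieldType) (eps beta : R) : 0 < eps -> 0 < beta ->
  exists eta mu : R, [/\ 0 < eta, 0 < mu &
  forall (V : finType) (h : V -> V -> V -> bool) (X1 X2 : {set V}), (0 < #|V|)%N ->
  symmetric3 h ->
  (forall X Y Z : {set V}, (1 / 8 + eps) * (#|X|%:R * #|Y|%:R * #|Z|%:R) - mu * #|V|%:R ^+ 3
     <= triples R h X Y Z) ->
  beta * #|V|%:R <= #|X1|%:R -> beta * #|V|%:R <= #|X2|%:R ->
  eta * #|V|%:R ^+ 4 <= \sum_y \sum_z (\sum_(x in X1) (h x y z)%:R) *
     (\sum_(x in X2) (h x y z)%:R)].
Proof.
move=> e0 b0; pose k := eps / 12.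
have k0 : 0 < k by rewrite divr_gt0 ?ltr0n.
pose N := ('I_6 + 'I_3)%type.
pose ps := [seq p <- enum {: N * N} | p.1 != p.2].
have psP : all (fun p => p.1 != p.2) ps by rewrite filter_all.
have [s [s0 s1 Hreg]] := regular_family k0 psP.
pose q := s * beta; have q0 : 0 < q by rewrite mulr_gt0.
(* The errors [m + 3 * t] of [box_density] add up to [4 * th * n ^+ 3], at most [eps / 4] of the
   box; [3 * k] is another [eps / 4]. Their sum stays below [eps]. *)
pose th := eps / 4 * q ^+ 3 / 4.
have th0 : 0 < th by rewrite !mulr_gt0 ?exprn_gt0 ?invr_gt0 ?ltr0n.
exists (th ^+ 2), th; split=> //; first by rewrite exprn_gt0.
move=> V h X1 X2 V0 hs lo X1b X2b; rewrite leNgt; apply/negP => small.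
set n : R := #|V|%:R in lo X1b X2b small.
have n0 : 0 < n by rewrite ltr0n.
have thn0 : 0 < th * n by apply: mulr_gt0.
pose d1 y z : R := \sum_(x in X1) (h x y z)%:R.
pose d2 y z : R := \sum_(x in X2) (h x y z)%:R.
have d10 y z : 0 <= d1 y z by apply: sumr_ge0.
have d20 y z : 0 <= d2 y z by apply: sumr_ge0.
pose G : rel V := fun y z => th * n <= d1 y z.
have sG : symmetric G.
  move=> y z; rewrite /G; congr (_ <= _); apply: eq_bigr => x _.
  by rewrite hs.2.
have in1 (X : {set V}) : X \subset X1 -> links_in h G (th * n ^+ 3) true X.
  move=> XX Y Z; apply: le_trans (triples_pairs R h (fun y z => ~~ G y z) Y Z XX) _.
  apply: le_trans (_ : \sum_(y : V) \sum_(z : V) th * n <= _).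
    apply: ler_sum => y _; apply: ler_sum => z _; rewrite -/(d1 y z) /G -ltNge.
    by case: ltP => [/ltW|_]; rewrite ?mul1r // mul0r ltW.
  rewrite !sum_cst -/n le_eqVlt; apply/orP; left; apply/eqP; ring.
have in2 (X : {set V}) : X \subset X2 -> links_in h G (th * n ^+ 3) false X.
  move=> XX Y Z.
  (* Markov: on [G] the factor [d1] is at least [th * n], while the whole sum is below
     [th ^+ 2 * n ^+ 4]. *)
  rewrite -(ler_pM2l thn0).
  apply: le_trans (_ : \sum_y \sum_z d1 y z * d2 y z <= _); last first.
    by apply: le_trans (ltW small) _; rewrite le_eqVlt; apply/orP; left; apply/eqP; ring.
  apply: le_trans (_ : th * n * \sum_y \sum_z (G y z)%:R * d2 y z <= _).
    rewrite ler_wpM2l ?(ltW thn0) //.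
    apply: le_trans (triples_pairs R h G Y Z XX); apply: triples_le => x y z.
    by rewrite /side negbK.
  rewrite mulr_sumr; apply: ler_sum => y _; rewrite mulr_sumr; apply: ler_sum => z _.
  rewrite /G; case: (lerP (th * n) (d1 y z)) => h1; last first.
    by rewrite mul0r mulr0 mulr_ge0.
  by rewrite mul1r ler_wpM2r.
pose U0 (i : N) := if is_inl i then X1 else X2.
have [U [U1 U2]] := Hreg V G U0.
have Us i : q * n <= #|U i|%:R.
  have [_ h1] := U1 i; apply: le_trans h1; rewrite -mulrA ler_wpM2l ?(ltW s0) //.
  by rewrite /U0; case: is_inl.
have Up i : 0 < #|U i|%:R :> R by apply: lt_le_trans (Us i); rewrite mulr_gt0.
have Ul i : links_in h G (th * n ^+ 3) (is_inl i) (U i).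
  have [+ _] := U1 i; rewrite /U0; case: (is_inl i); [exact: in1 | exact: in2].
have Ur i j : i != j -> regular G k (U i) (U j).
  by move=> ij; apply: (U2 (i, j)); rewrite mem_filter /= ij mem_enum.
apply: (@no_density_pattern R (fun i j => density R G (U i) (U j))).
- by move=> i j; apply: density_sym.
- by move=> i j; rewrite density_ge0 density_le1.
move=> i j l ij jl li.
have il : i != l by rewrite eq_sym.
have := box_density hs (ltW k0) (lo (U i) (U j) (U l)) (Ul i) (Ul j) (Ul l)
  (Ur j l jl) (Ur i l il) (Ur i j ij).
set D := _ * _ * sideD _ _; set v := _ * _ * #|U l|%:R.
have v0 : 0 < v by rewrite !mulr_gt0.
have vq : q ^+ 3 * n ^+ 3 <= v.
  have qn0 : 0 <= q * n by rewrite ltW // mulr_gt0.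
  rewrite -exprMn !exprS expr0 mulr1 mulrA; apply: ler_pM => //.
    exact: mulr_ge0.
  exact: ler_pM.
move=> H; rewrite ltNge; apply/negP => D8.
have : (1 / 8 + eps) * v <= (1 / 8 + 3 * k) * v + eps / 4 * v.
  apply: le_trans H _; apply: lerD; first by rewrite ler_wpM2r ?(ltW v0) // lerD2r.
  apply: le_trans (_ : eps / 4 * (q ^+ 3 * n ^+ 3) <= _).
    by rewrite le_eqVlt; apply/orP; left; apply/eqP; rewrite /th; field.
  by rewrite ler_wpM2l // divr_ge0 // ltW.
rewrite -mulrDl ler_pM2r // /k; lra.
Qed.

(** * Linked vertices *)

Lemma card_sumR (R : pzSemiRingType) (T : finType) (P : pred T) :
  #|[set x | P x]|%:R = \sum_x (P x)%:R :> R.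
Proof.
rewrite -sum1dep_card natr_sum big_mkcond; apply: eq_bigr => x _.
by case: (P x).
Qed.

(** Values reaching the threshold contribute at most [b] each, the others at most [t]. *)
Lemma sum_threshold (R : realFieldType) (T : finType) (phi : T -> R) (a b t : R) :
  (forall x, phi x <= b) -> 0 <= t -> 0 <= b ->
  a <= \sum_x phi x -> a <= #|[set x | t <= phi x]|%:R * b + #|T|%:R * t.
Proof.
move=> pb t0 b0 H; apply: le_trans H _.
rewrite card_sumR mulr_suml mulrC -sum_cst -big_split; apply: ler_sum => x _ /=.
case: (lerP t (phi x)) => h; rewrite ?mul1r ?mul0r ?add0r; last exact: ltW.
by apply: le_trans (pb x) _; rewrite lerDl.
Qed.

Definition common (R : realFieldType) (V : finType) (h : V -> V -> V -> bool) (x x' : V) : R :=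
  \sum_y \sum_z (h x y z && h x' y z)%:R.

Lemma common_le (R : realFieldType) (V : finType) (h : V -> V -> V -> bool) (x x' : V) :
  common R h x x' <= #|V|%:R ^+ 2.
Proof.
apply: le_trans (_ : \sum_(y : V) \sum_(z : V) 1 <= _); last first.
  by rewrite !sum_cst mul1r expr2.
by apply: ler_sum => y _; apply: ler_sum => z _; rewrite lern1 leq_b1.
Qed.

Lemma common_sym (R : realFieldType) (V : finType) (h : V -> V -> V -> bool) (x x' : V) :
  common R h x x' = common R h x' x.
Proof. by apply: eq_bigr => y _; apply: eq_bigr => z _; rewrite andbC. Qed.

Definition codegree_ge (R : realFieldType) (V : finType) (h : V -> V -> V -> bool) (a : R) :=
  forall y z, y != z -> a <= \sum_x (h x y z)%:R.

(** Double counting: [u] has at least [alpha * n * (n - 1)] ordered link pairs, each in at least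
    [alpha * n] links. A threshold turns the total into many vertices. *)
Lemma neighbourhood_large (R : realFieldType) (V : finType) (h : V -> V -> V -> bool)
    (alpha : R) (u : V) : 0 < alpha -> (1 < #|V|)%N -> symmetric3 h ->
  (forall x y z, h x y z -> y != z) ->
  codegree_ge h (alpha * #|V|%:R) ->
  alpha ^+ 2 / 4 * #|V|%:R <=
    #|[set x | alpha ^+ 2 / 4 * #|V|%:R ^+ 2 <= common R h u x]|%:R.
Proof.
move=> a0 V1 [h12 h23] hne cod; set n : R := #|V|%:R.
have n2 : 2 <= n by rewrite ler_nat.
have n0 : 0 < n by lra.
have an0 : 0 < alpha * n by rewrite mulr_gt0.
have e0 : 0 <= alpha ^+ 2 / 4 by rewrite divr_ge0 ?exprn_ge0 ?(ltW a0).
have deg : alpha * n * (n - 1) <= \sum_y \sum_z (h u y z)%:R.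
  have -> : alpha * n * (n - 1) = \sum_(y : V | y != u) alpha * n.
    have : \sum_(y : V) alpha * n = alpha * n * n by rewrite sum_cst.
    rewrite (bigD1 u) //= => H; apply: (addrI (alpha * n)); rewrite H; ring.
  rewrite [leRHS](bigD1 u) //= -[leLHS]add0r lerD ?sumr_ge0 //.
  apply: ler_sum => y yu; apply: le_trans (cod u y _) _; first by rewrite eq_sym.
  by apply: ler_sum => z _; rewrite h12 h23.
have tot : alpha * n * (alpha * n * (n - 1)) <= \sum_x common R h u x.
  apply: le_trans (_ : alpha * n * (\sum_y \sum_z (h u y z)%:R) <= _).
    by rewrite ler_wpM2l // ltW.
  rewrite /common [leRHS]exchange_big mulr_sumr; apply: ler_sum => y _ /=.
  rewrite [leRHS]exchange_big mulr_sumr; apply: ler_sum => z _ /=.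
  case huyz: (h u y z); last by rewrite /= mulr0 sumr_ge0.
  rewrite /= mulr1; apply: le_trans (cod y z (hne _ _ _ huyz)) _.
  by apply: ler_sum => x _; rewrite ler_nat; case: (h x y z).
have := sum_threshold (common_le R h u) _ _ tot.
move=> /(_ (alpha ^+ 2 / 4 * n ^+ 2)); rewrite -/n => H.
have {H} := H (mulr_ge0 e0 (exprn_ge0 2 (ltW n0))) (exprn_ge0 2 (ltW n0)).
set N := #|_|%:R => H.
have : alpha ^+ 2 / 4 * n * n ^+ 2 <= N * n ^+ 2; last by rewrite ler_pM2r ?exprn_gt0.
apply: le_trans (_ : alpha * n * (alpha * n * (n - 1)) - n * (alpha ^+ 2 / 4 * n ^+ 2) <= _); last by lra.
rewrite -subr_ge0.
(* Nonnegativity of this difference is where [n >= 2] enters. *)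
rewrite (_ : _ - _ = alpha ^+ 2 * n ^+ 2 * ((n - 2) / 2)); last by field.
by rewrite !mulr_ge0 ?exprn_ge0 ?(ltW a0) ?(ltW n0) ?invr_ge0 // subr_ge0.
Qed.

Definition linking (R : realFieldType) (V : finType) (h : V -> V -> V -> bool) (t : R) (x x' : V) :=
  t * #|V|%:R ^+ 2 <= common R h x x'.

(* Both neighbourhoods are linear in size by the codegree condition, so
   [robust_link] joins them. *)
Lemma linking_paths (R : archiRealFieldType) (eps alpha : R) : 0 < eps -> 0 < alpha ->
  exists eta eta' mu : R, [/\ 0 < eta, 0 < eta', 0 < mu &
  forall (V : finType) (h : V -> V -> V -> bool), (1 < #|V|)%N ->
  symmetric3 h -> (forall x y z, h x y z -> y != z) ->
  (forall X Y Z : {set V}, (1 / 8 + eps) * (#|X|%:R * #|Y|%:R * #|Z|%:R) - mu * #|V|%:R ^+ 3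
     <= triples R h X Y Z) ->
  codegree_ge h (alpha * #|V|%:R) ->
  forall u w : V, eta' * #|V|%:R ^+ 2 <=
    #|[set p : V * V | [&& linking h eta u p.1, linking h eta p.1 p.2 & linking h eta p.2 w]]|%:R].
Proof.
move=> e0 a0; pose b := alpha ^+ 2 / 4.
have b0 : 0 < b by rewrite divr_gt0 ?exprn_gt0 ?ltr0n.
have [eta2 [mu [eta20 mu0 H]]] := robust_link e0 b0.
(* The bound by [b] makes vertices of [X1] and [X2] linked to [u] and [w]; the bound by [eta2 / 2]
   lets the threshold keep half of the total. *)
pose eta := Num.min b (eta2 / 2).
have e2 : eta <= eta2 / 2 by rewrite /eta ge_min lexx orbT.
have eb : eta <= b by rewrite /eta ge_min lexx.
have eta0 : 0 < eta by rewrite lt_min b0 divr_gt0 ?ltr0n.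
exists eta, (eta2 / 2), mu; split; rewrite ?divr_gt0 ?ltr0n //.
move=> V h V1 hs hne lo cod u w.
clearbody eta; set n : R := #|V|%:R.
have n0 : 0 < n by rewrite ltr0n ltnW.
have n2 : 0 < n ^+ 2 by rewrite exprn_gt0.
pose X1 := [set x | b * n ^+ 2 <= common R h u x].
pose X2 := [set x | b * n ^+ 2 <= common R h w x].
have := H V h X1 X2 (ltnW V1) hs lo (neighbourhood_large u a0 V1 hs hne cod)
  (neighbourhood_large w a0 V1 hs hne cod).
rewrite -/n => big.
pose phi (p : V * V) := ((p.1 \in X1) && (p.2 \in X2))%:R * common R h p.1 p.2.
have tot : eta2 * n ^+ 4 <= \sum_p phi p.
  apply: le_trans big _; rewrite le_eqVlt; apply/orP; left; apply/eqP.
  rewrite -(pair_big xpredT xpredT (fun x x' => phi (x, x'))) /= /phi /=.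
  under [LHS]eq_bigr => y _ do under eq_bigr => z _ do rewrite mulr_suml.
  under [LHS]eq_bigr => y _ do rewrite exchange_big /=.
  rewrite exchange_big [LHS]big_mkcond /=; apply: eq_bigr => x _.
  case: (x \in X1); last by rewrite big1 // => x' _; rewrite mul0r.
  under [LHS]eq_bigr => y _ do under eq_bigr => z _ do rewrite mulr_sumr.
  under [LHS]eq_bigr => y _ do rewrite exchange_big /=.
  rewrite exchange_big [LHS]big_mkcond /=; apply: eq_bigr => x' _.
  case: (x' \in X2); last by rewrite mul0r.
  rewrite mul1r /common; apply: eq_bigr => y _; apply: eq_bigr => z _.
  by rewrite -natrM mulnb.
have phib p : phi p <= n ^+ 2.
  rewrite /phi; case: (_ && _); rewrite ?mul0r ?(ltW n2) // mul1r.
  exact: common_le.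
have en0 : 0 <= eta * n ^+ 2 by rewrite mulr_ge0 ?(ltW eta0) ?(ltW n2).
have := sum_threshold phib en0 (ltW n2) tot.
rewrite card_prod natrM -/n.
set S := [set x | _] => HS.
have SS : S \subset [set p : V * V |
    [&& linking h eta u p.1, linking h eta p.1 p.2 & linking h eta p.2 w]].
  apply/subsetP => -[x x']; rewrite !inE /phi /= /linking -/n.
  have pos : 0 < eta * n ^+ 2 by rewrite mulr_gt0.
  case: (boolP (_ && _)) => [/andP[hx hx']|_]; last by rewrite mul0r leNgt pos.
  rewrite mul1r => ->; rewrite inE in hx; rewrite inE common_sym in hx'.
  have le : eta * n ^+ 2 <= b * n ^+ 2 by rewrite ler_pM2r.
  by rewrite !(le_trans le).
apply: le_trans (ler_card R SS).
rewrite -(ler_pM2r n2).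
have : eta * n ^+ 4 <= eta2 / 2 * n ^+ 4 by rewrite ler_pM2r ?exprn_gt0.
move: HS; have -> : n * n * (eta * n ^+ 2) = eta * n ^+ 4 by ring.
have -> : eta2 / 2 * n ^+ 2 * n ^+ 2 = eta2 * n ^+ 4 - eta2 / 2 * n ^+ 4 by field.
lra.
Qed.

(** * Counting absorbers *)

Definition upd (V I : finType) (r : I) (g : {ffun I -> V}) (u : V) : {ffun I -> V} :=
  [ffun i => if i == r then u else g i].

(** A copy rooted at [x] in which [x] may be traded for [u]: the other vertices complete both. *)
Definition step (V I : finType) (c : I -> 'I_3) (r : I) (h : V -> V -> V -> bool)
    (u x : V) (g : {ffun I -> V}) :=
  [&& g r == x, rainbow c h g & rainbow c h (upd r g u)].

(** Rainbow maps are counted in the 3-graph of edges over common link pairs of [u] and [x], whose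
    density is at least [alpha * eta] by the codegree condition. In such a map the root may be
    replaced by either vertex. *)
Lemma step_count (R : realFieldType) (V I : finType) (c : I -> 'I_3) (r : I)
    (h : V -> V -> V -> bool) (alpha eta : R) (u x : V) :
  val (c r) = 0%N -> 0 <= alpha -> 0 <= eta ->
  (forall x y z, h x y z -> y != z) ->
  codegree_ge h (alpha * #|V|%:R) -> linking h eta u x ->
  (alpha * eta) ^+ (#|I| ^ 3) * #|V|%:R ^+ #|I| <=
    #|V|%:R * #|[set g | step c r h u x g]|%:R.
Proof.
move=> cr a0 e0 hne cod lk; set n : R := #|V|%:R.
pose h' p y z := [&& h p y z, h u y z & h x y z].
have dens : alpha * eta * (#|V| ^ 3)%:R <=
    #|[set t : V * V * V | h' t.1.1 t.1.2 t.2]|%:R :> R.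
  have -> : alpha * eta * (#|V| ^ 3)%:R = alpha * n * (eta * n ^+ 2) :> R.
    by rewrite natrX -/n; ring.
  apply: le_trans (_ : alpha * n * common R h u x <= _).
    by rewrite ler_wpM2l // mulr_ge0.
  have -> : #|[set t : V * V * V | h' t.1.1 t.1.2 t.2]|%:R =
      \sum_p \sum_y \sum_z (h' p y z)%:R :> R.
    rewrite card_sumR (pair_big xpredT xpredT (fun p y => \sum_z (h' p y z)%:R)) /=.
    by rewrite (pair_big xpredT xpredT (fun p z => (h' p.1 p.2 z)%:R)) /=.
  rewrite [leRHS]exchange_big mulr_sumr; apply: ler_sum => y _.
  rewrite [leRHS]exchange_big mulr_sumr; apply: ler_sum => z _ /=.
  rewrite /h'; case E: (h u y z); last by rewrite /= mulr0 sumr_ge0.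
  case: (h x y z); last by rewrite /= mulr0 sumr_ge0.
  rewrite /= mulr1; apply: le_trans (cod y z (hne _ _ _ E)) _.
  by apply: ler_sum => p _; rewrite andbT.
have ae0 : 0 <= alpha * eta by rewrite mulr_ge0.
have := rainbow_density c ae0 dens; rewrite natrX -/n => H.
apply: le_trans H _; rewrite -natrM ler_nat mulnC.
rewrite -[#|V|]cardsT -cardsX.
(* The root is overwritten by [x] and its old value recorded, at the cost of a factor [#|V|]. *)
apply: (leq_card_bij (h := fun g : {ffun I -> V} => (upd r g x, g r))).
  move=> g g' _ _ [/ffunP E Er]; apply/ffunP => i.
  by have := E i; rewrite !ffunE; case: eqP => [->|].
move=> g; rewrite !inE => /rainbowP hg; rewrite andbT /step ffunE eqxx eqxx /=.
have cne i k : val (c i) = k.+1 -> (i == r) = false.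
  by move=> ci; apply/eqP => ir; move: ci; rewrite ir cr.
apply/andP; split; apply/rainbowP => i j k ci cj ck; rewrite !ffunE (cne j 0%N) ?(cne k 1%N) //.
  by case: eqP => [ir|_]; have /and3P[] := hg i j k ci cj ck.
by case: eqP => [ir|_]; have /and3P[] := hg i j k ci cj ck.
Qed.

Definition triple (V I : finType) : finType :=
  ({ffun I -> V} * {ffun I -> V} * {ffun I -> V})%type.

(** Three successive exchanges from [u] to [w]; the inner vertices are stored as the roots of the
    first two maps. *)
Definition chain (V I : finType) (c : I -> 'I_3) (r : I) (h : V -> V -> V -> bool)
    (u w : V) (t : triple V I) :=
  [&& step c r h u (t.1.1 r) t.1.1, step c r h (t.1.1 r) (t.1.2 r) t.1.2 &
      step c r h (t.1.2 r) w t.2].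

(** For a fixed path of linked pairs the three steps are chosen independently. Different paths yield
    disjoint families, the inner vertices being the roots. *)
Lemma chain_count (R : realFieldType) (V I : finType) (c : I -> 'I_3) (r : I)
    (h : V -> V -> V -> bool) (alpha eta eta' : R) (u w : V) :
  val (c r) = 0%N -> 0 <= alpha -> 0 <= eta -> (0 < #|V|)%N ->
  (forall x y z, h x y z -> y != z) ->
  codegree_ge h (alpha * #|V|%:R) ->
  eta' * #|V|%:R ^+ 2 <=
    #|[set p : V * V | [&& linking h eta u p.1, linking h eta p.1 p.2 & linking h eta p.2 w]]|%:R ->
  eta' * (alpha * eta) ^+ (3 * #|I| ^ 3) * #|V|%:R ^+ (3 * #|I|) <=
    #|V|%:R * #|[set t | chain c r h u w t]|%:R.
Proof.
move=> cr a0 e0 V0 hne cod.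
set P := [set p : V * V | _] => HP.
set n : R := #|V|%:R; set z := (alpha * eta) ^+ (#|I| ^ 3); set m := #|I|.
have n0 : 0 < n by rewrite ltr0n.
have z0 : 0 <= z by rewrite exprn_ge0 ?mulr_ge0.
pose S a b := [set g | step c r h a b g].
have HS a b : linking h eta a b -> z * n ^+ m <= n * #|S a b|%:R.
  by apply: step_count.
have le1 : (\sum_(p in P) #|S u p.1| * #|S p.1 p.2| * #|S p.2 w| <=
    #|[set t | chain c r h u w t]|)%N.
  apply: leq_trans (_ : \sum_(p in P)
     #|[set t | chain c r h u w t & (t.1.1 r, t.1.2 r) == p]| <= _)%N.
    apply: leq_sum => -[x x'] _; rewrite -!cardsX; apply: subset_leq_card.
    apply/subsetP => -[[g0 g1] g2]; rewrite !inE /chain /= -andbA => /and3P[s0 s1 s2].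
    move: (s0) (s1) => /andP[/eqP e1 _] /andP[/eqP e2 _].
    by rewrite e1 e2 s0 s1 s2 eqxx.
  rewrite -sum1_card (partition_big (fun t : triple V I => (t.1.1 r, t.1.2 r)) xpredT) //=.
  rewrite big_mkcond; apply: leq_sum => p _; case: ifP => // _.
  by rewrite -sum1dep_card; apply: eq_leq; apply: eq_bigl => t; rewrite !inE.
have n3 : 0 < n ^+ 2 by rewrite exprn_gt0.
(* Together with the factor already present this gives [n ^+ 3], one [n] for each step count. *)
rewrite -(ler_pM2r n3).
apply: le_trans (_ : n ^+ 3 * (\sum_(p in P) #|S u p.1| * #|S p.1 p.2| * #|S p.2 w|)%N%:R <= _);
  last first.
  rewrite [leRHS]mulrAC -exprS ler_wpM2l ?exprn_ge0 ?(ltW n0) //.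
  by rewrite ler_nat.
rewrite natr_sum mulr_sumr.
apply: le_trans (_ : \sum_(p in P) (z * n ^+ m) ^+ 3 <= _); last first.
  apply: ler_sum => p; rewrite inE => /and3P[l1 l2 l3].
  have {l1} := HS _ _ l1; have {l2} := HS _ _ l2; have {l3} := HS _ _ l3.
  rewrite !natrM; set A := #|S u _|%:R; set B := #|S _ w|%:R; set C := #|_|%:R.
  have zn : 0 <= z * n ^+ m by exact: (mulr_ge0 z0 (exprn_ge0 m (ltW n0))).
  move=> h3 h2 h1.
  have -> : n ^+ 3 * (A * C * B) = (n * A) * (n * C) * (n * B) by ring.
  rewrite (_ : (z * n ^+ m) ^+ 3 = (z * n ^+ m) * (z * n ^+ m) * (z * n ^+ m)); last by ring.
  exact: (ler_pM (mulr_ge0 zn zn) zn (ler_pM zn zn h1 h2) h3).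
rewrite sum_cst_in.
have -> : eta' * (alpha * eta) ^+ (3 * m ^ 3) * n ^+ (3 * m) * n ^+ 2 =
    (z * n ^+ m) ^+ 3 * (eta' * n ^+ 2).
  have -> : (alpha * eta) ^+ (3 * m ^ 3) = z ^+ 3 by rewrite mulnC exprM.
  have -> : n ^+ (3 * m) = (n ^+ m) ^+ 3 by rewrite mulnC exprM.
  by move: (n ^+ m) => e; ring.
by apply: ler_wpM2l => //; apply/exprn_ge0/mulr_ge0; rewrite // exprn_ge0 ?(ltW n0).
Qed.

(* A i = (g0, g1, g2) trades Q i for g0 r, then g0 r for g1 r, then g1 r for
   g2 r; the vertices g2 r left over for the various i form one more copy. *)
Definition absorber (V I : finType) (c : I -> 'I_3) (r : I) (h : V -> V -> V -> bool)
    (Q : {ffun I -> V}) (A : {ffun I -> triple V I}) :=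
  [forall i, chain c r h (Q i) ((A i).2 r) (A i)] &&
  rainbow c h [ffun i => (A i).2 r].

Lemma chain_end (V I : finType) (c : I -> 'I_3) (r : I) (h : V -> V -> V -> bool) u w t :
  chain c r h u w t -> t.2 r = w.
Proof. by move=> /and3P[_ _ /and3P[/eqP]]. Qed.

(** Once a rainbow map [w] of end roots is fixed, the chains for the different [i] are independent.
    They lose one factor [#|V|] for each [i], which the choice of [w] restores. *)
Lemma absorber_count (R : realFieldType) (V I : finType) (c : I -> 'I_3) (r : I)
    (h : V -> V -> V -> bool) (p q : R) (Q : {ffun I -> V}) :
  0 <= q -> (0 < #|V|)%N ->
  p * #|V|%:R ^+ #|I| <= #|[set g : {ffun I -> V} | rainbow c h g]|%:R ->
  (forall u w, q * #|V|%:R ^+ (3 * #|I|) <= #|V|%:R * #|[set t | chain c r h u w t]|%:R) ->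
  p * q ^+ #|I| * #|V|%:R ^+ (3 * #|I| ^ 2) <= #|[set A | absorber c r h Q A]|%:R.
Proof.
move=> q0 V0 Hp Hq; set n : R := #|V|%:R; set m := #|I|.
have n0 : 0 < n by rewrite ltr0n.
pose C (w : {ffun I -> V}) i := [set t | chain c r h (Q i) (w i) t].
have le1 : (\sum_(w : {ffun I -> V} | rainbow c h w) \prod_i #|C w i| <= #|[set A | absorber c r h Q A]|)%N.
  rewrite -sum1_card (partition_big (fun A : {ffun I -> triple V I} =>
    [ffun i => (A i).2 r]) (fun w : {ffun I -> V} => rainbow c h w)) /=; last first.
    by move=> A; rewrite inE => /andP[].
  apply: leq_sum => w rw.
  have -> : (\prod_i #|C w i| = \sum_(A in family (fun i => mem (C w i))) 1)%N.
    under eq_bigr => i _ do rewrite -sum1_card.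
    by rewrite bigA_distr_big_dep; apply: eq_bigr => A _; rewrite big1.
  rewrite [leqLHS]big_mkcond [leqRHS]big_mkcond; apply: leq_sum => A _.
  case: ifP => // /familyP FA.
  have E i : (A i).2 r = w i by have := FA i; rewrite inE; apply: chain_end.
  have E' : [ffun i => (A i).2 r] = w by apply/ffunP => i; rewrite ffunE E.
  rewrite inE /absorber E' rw eqxx !andbT.
  have -> // : [forall i, chain c r h (Q i) ((A i).2 r) (A i)].
  by apply/forallP => i; have := FA i; rewrite inE E.
have nm : 0 < n ^+ m by rewrite exprn_gt0.
rewrite -(ler_pM2r nm).
apply: le_trans (_ : (\sum_(w : {ffun I -> V} | rainbow c h w) \prod_i #|C w i|)%N%:R * n ^+ m <= _);
  last by rewrite ler_wpM2r ?(ltW nm) // ler_nat.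
rewrite natr_sum mulr_suml.
apply: le_trans (_ : \sum_(w : {ffun I -> V} | rainbow c h w) (q * n ^+ (3 * m)) ^+ m <= _); last first.
  apply: ler_sum => w _; rewrite natr_prod.
  have -> : n ^+ m = \prod_(i : I) n by rewrite prodr_const.
  have -> : (q * n ^+ (3 * m)) ^+ m = \prod_(i : I) (q * n ^+ (3 * m)) by rewrite prodr_const.
  rewrite -big_split /=; apply: ler_prod => i _; apply/andP; split.
    by rewrite mulr_ge0 ?exprn_ge0 ?(ltW n0).
  by rewrite [leRHS]mulrC; apply: Hq.
have -> : \sum_(w : {ffun I -> V} | rainbow c h w) (q * n ^+ (3 * m)) ^+ m =
    (q * n ^+ (3 * m)) ^+ m * #|[set w : {ffun I -> V} | rainbow c h w]|%:R.
  by rewrite -sum_cst_in; apply: eq_bigl => w; rewrite inE.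
have -> : p * q ^+ m * n ^+ (3 * m ^ 2) * n ^+ m = (q * n ^+ (3 * m)) ^+ m * (p * n ^+ m).
    by rewrite exprMn -exprM -mulnA mulnn; ring.
by apply: ler_wpM2l => //; rewrite exprn_ge0 ?mulr_ge0 ?exprn_ge0 ?(ltW n0).
Qed.

(** * Choosing disjoint absorbers *)

Lemma exists_ge_mean (R : realFieldType) (T : finType) (phi : T -> R) (a : R) :
  (0 < #|T|)%N -> a * #|T|%:R <= \sum_x phi x -> exists x, a <= phi x.
Proof.
move=> /card_gt0P[x0 _] H; have [/existsP//|/existsPn no] := boolP [exists x, a <= phi x].
suff : \sum_x phi x < \sum_(x : T) a by rewrite sum_cst ltNge H.
apply: ltr_sum => [|x _]; last by rewrite ltNge no.
by apply/hasP; exists x0; rewrite ?mem_index_enum.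
Qed.

(* Derandomised choice: each new structure shrinks the potential
   \sum_Q 2^(- number of structures serving Q) by a constant factor. *)
Lemma greedy_family (R : realFieldType) (S Q V : finType) (vs : S -> seq V)
    (good : pred S) (serves : Q -> pred S) (s w r : nat) (z : R) :
  0 < z <= 1 -> (0 < #|Q|)%N -> (0 < #|S|)%N -> (forall A, size (vs A) = s) ->
  (forall (W : {set V}) q, (#|W| <= w)%N ->
     z * #|S|%:R <= #|[set A | [&& serves q A, good A, uniq (vs A) &
       all [predC W] (vs A)]]|%:R) ->
  (s * r <= w)%N ->
  exists As : seq S, [/\ all good As, uniq (flatten (map vs As)), size As = r &
    \sum_q (2^-1 : R) ^+ count (serves q) As <= #|Q|%:R * (1 - z / 2) ^+ r].
Proof.
move=> /andP[z0 z1] Q0 S0 sz H; elim: r => [|r IH] sr.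
  by exists [::]; split; rewrite //= sum_cst mul1r expr0 mulr1.
have [As [gAs uAs szAs pot]] := IH (leq_trans (leq_mul (leqnn s) (leqnSn r)) sr).
pose W := [set x in flatten (map vs As)].
have Ww : (#|W| <= w)%N.
  apply: leq_trans sr; rewrite cardsE; apply: leq_trans (card_size _) _.
  rewrite size_flatten /shape -map_comp (eq_map (g := fun=> s)); last by move=> A /=.
  rewrite sumnE big_map big_const_seq count_predT szAs iter_addn_0.
  by rewrite leq_mul2l leqnSn orbT.
pose wt q : R := (2^-1) ^+ count (serves q) As.
have wt0 q : 0 < wt q by rewrite exprn_gt0 // invr_gt0 ltr0n.
pose ok A := [&& good A, uniq (vs A) & all [predC W] (vs A)].
pose phi A : R := \sum_q (serves q A && ok A)%:R * wt q.
(* By averaging, some [A] serves a weighted proportion [z] of all tuples. As [phi] vanishes where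
   [ok] fails, this [A] is also admissible. *)
have [A HA] : exists A, z * \sum_q wt q <= phi A.
  apply: exists_ge_mean => //; rewrite /phi exchange_big /= mulr_sumr mulr_suml.
  apply: ler_sum => q _; rewrite -mulr_suml mulrAC ler_pM2r //.
  by rewrite -(card_sumR R (fun A => serves q A && ok A)); apply: H.
have sum0 : 0 < \sum_q wt q.
  have /card_gt0P[q0 _] := Q0; rewrite (bigD1 q0) //=.
  by rewrite ltr_wpDr // sumr_ge0 // => q _; apply: ltW.
have okA : ok A.
  apply/negPn/negP => nok; move: HA; rewrite /phi (negbTE nok) [leRHS]big1.
    by rewrite leNgt mulr_gt0.
  by move=> q _; rewrite andbF mul0r.
have /and3P[gA uA aA] := okA.
exists (A :: As); split; rewrite /= ?gA ?szAs //.
  rewrite cat_uniq uA uAs andbT /=; apply/hasPn => x xAs; apply/negP => xA.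
  by have /allP/(_ _ xA) := aA; rewrite /= inE xAs.
rewrite exprSr mulrA; apply: le_trans (_ : (\sum_q wt q) * (1 - z / 2) <= _); last first.
  by rewrite ler_wpM2r //; lra.
(* Serving a tuple halves its weight. *)
have -> : \sum_q (2^-1 : R) ^+ (serves q A + count (serves q) As) =
   \sum_q wt q - phi A / 2.
  rewrite /phi mulr_suml -sumrB; apply: eq_bigr => q _; rewrite exprD -/(wt q) okA andbT.
  by case: (serves q A) => /=; rewrite ?expr1 ?expr0; field.
by move: HA; move: (\sum_q wt q) (phi A) => a b ab; lra.
Qed.

(** * Tilings as lists of vertices *)

Section Tiling.
Variables (V I : finType) (P : pred {ffun I -> V}).

(* The pieces may overlap or be non-injective; that is excluded as soon as l
   has no repetition. *)
Definition tileable (l : seq V) := exists s : seq {ffun I -> V},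
  all P s /\ perm_eq (flatten [seq codom g | g : {ffun I -> V} <- s]) l.

Lemma tileable0 : tileable [::].
Proof. by exists [::]. Qed.

Lemma tileable_cat l1 l2 : tileable l1 -> tileable l2 -> tileable (l1 ++ l2).
Proof.
move=> [s1 [a1 p1]] [s2 [a2 p2]]; exists (s1 ++ s2); rewrite all_cat a1 a2; split=> //.
by rewrite map_cat flatten_cat perm_cat.
Qed.

Lemma tileable_perm l1 l2 : perm_eq l1 l2 -> tileable l1 -> tileable l2.
Proof. by move=> p [s [a p1]]; exists s; split=> //; apply: perm_trans p1 p. Qed.

Lemma tileable_flatten (T : Type) (vs : T -> seq V) (good : pred T) (As : seq T) :
  (forall A, good A -> tileable (vs A)) -> all good As -> tileable (flatten (map vs As)).
Proof.
move=> H; elim: As => [|A As IH] /=; first by move=> _; apply: tileable0.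
by move=> /andP[gA gAs]; apply: tileable_cat; [apply: H | apply: IH].
Qed.

Lemma tileable_match (S : eqType) (vs : S -> seq V) (good : pred S)
    (serves : {ffun I -> V} -> pred S) (As : seq S) (Qs : seq {ffun I -> V}) :
  (forall A, good A -> tileable (vs A)) ->
  (forall q A, serves q A -> tileable (vs A ++ codom q)) ->
  all good As -> (forall q, (size Qs <= count (serves q) As)%N) ->
  tileable (flatten (map vs As) ++ flatten [seq codom q | q : {ffun I -> V} <- Qs]).
Proof.
move=> Hg Hs; elim: Qs As => [|q Qs IH] As gAs cnt.
  by rewrite cats0; apply: tileable_flatten Hg gAs.
have /hasP[A AAs sA] : has (serves q) As by rewrite has_count; apply: leq_trans (cnt q).
have pA := perm_to_rem AAs.
have gR : all good (rem A As) by move: gAs; rewrite (perm_all _ pA) /= => /andP[].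
have cR q' : (size Qs <= count (serves q') (rem A As))%N.
  have := cnt q'; have /seq.permP/(_ (serves q')) /= -> := pA.
  by case: (serves q' A); rewrite /= ?add1n ?add0n // => /ltnW.
apply: tileable_perm (tileable_cat (Hs q A sA) (IH _ gR cR)).
apply/seq.permP => a; have /seq.permP/(_ a) := perm_flatten (perm_map vs pA).
rewrite /= !count_cat => ->; lia.
Qed.

End Tiling.

Lemma count_codom (V I : finType) (g : {ffun I -> V}) a :
  count a (codom g) = (\sum_i a (g i))%N.
Proof.
rewrite codomE count_map -sum1_count big_mkcond big_enum /=.
by apply: eq_bigr => i _; case: (a _).
Qed.

(** Multiset balance of one exchange, additive because natural subtraction truncates. *)
Lemma count_upd (V I : finType) (r : I) (g : {ffun I -> V}) (u : V) a :
  (count a (codom (upd r g u)) + a (g r) = count a (codom g) + a u)%N.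
Proof.
rewrite !count_codom (bigD1 r) //= [X in (_ = X + _)%N](bigD1 r) //= ffunE eqxx.
rewrite addnAC [RHS]addnAC; congr (_ + _)%N; first exact: addnC.
by apply: eq_bigr => i ir; rewrite ffunE (negbTE ir).
Qed.

Lemma count_flatten_codom (V I : finType) (T : finType) (G : T -> {ffun I -> V}) a :
  count a (flatten [seq codom g | g : {ffun I -> V} <- [seq G t | t <- enum T]]) =
  (\sum_t count a (codom (G t)))%N.
Proof. by rewrite count_flatten sumnE 3!big_map big_enum. Qed.

(** * Vertices and tilings of an absorber *)

Section Absorbers.
Variables (V I : finType) (c : I -> 'I_3) (r : I) (h : V -> V -> V -> bool).

(** Written as a single map, an absorber falls under [card_not_avoiding]. *)
Definition flat (A : {ffun I -> triple V I}) : {ffun I * (I + I + I) -> V} :=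
  [ffun j => match j.2 with
             | inl (inl l) => (A j.1).1.1 l
             | inl (inr l) => (A j.1).1.2 l
             | inr l => (A j.1).2 l
             end].

Lemma flat_inj : injective flat.
Proof.
move=> A B /ffunP E; apply/ffunP => i.
suff : [/\ (A i).1.1 = (B i).1.1, (A i).1.2 = (B i).1.2 & (A i).2 = (B i).2].
  by case: (A i) => [[a b] e]; case: (B i) => [[a' b'] e'] /= [-> -> ->].
split; apply/ffunP => l.
- by have := E (i, inl (inl l)); rewrite !ffunE.
- by have := E (i, inl (inr l)); rewrite !ffunE.
- by have := E (i, inr l); rewrite !ffunE.
Qed.

Lemma card_flat : #|{: I * (I + I + I)}| = (3 * #|I| ^ 2)%N.
Proof. by rewrite card_prod !card_sum !expnS expn0; lia. Qed.

Definition vertices (A : {ffun I -> triple V I}) := codom (flat A).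

Lemma size_vertices A : size (vertices A) = (3 * #|I| ^ 2)%N.
Proof. by rewrite size_codom card_flat. Qed.

Lemma count_vertices A a : count a (vertices A) =
  (\sum_i (count a (codom (A i).1.1) + count a (codom (A i).1.2) + count a (codom (A i).2)))%N.
Proof.
rewrite count_codom.
have -> : (\sum_j a (flat A j) = \sum_i \sum_(k : I + I + I) a (flat A (i, k)))%N.
  by rewrite pair_big; apply: eq_bigr => -[i k].
apply: eq_bigr => i _; rewrite !big_sumType /= !count_codom.
by congr (_ + _ + _)%N; apply: eq_bigr => l _; rewrite ffunE.
Qed.

Definition self_tiled (A : {ffun I -> triple V I}) :=
  [forall i, [&& rainbow c h (A i).1.1, rainbow c h (A i).1.2 & rainbow c h (A i).2]].

Lemma absorber_self_tiled Q A : absorber c r h Q A -> self_tiled A.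
Proof.
move=> /andP[/forallP H _]; apply/forallP => i.
by have /and3P[/and3P[_ -> _] /and3P[_ -> _] /and3P[_ -> _]] := H i.
Qed.

Lemma self_tiled_tileable A : self_tiled A ->
  tileable (fun g : {ffun I -> V} => rainbow c h g) (vertices A).
Proof.
move=> /forallP H.
exists ([seq (A i).1.1 | i <- enum I] ++ [seq (A i).1.2 | i <- enum I] ++
  [seq (A i).2 | i <- enum I]); split.
  rewrite !all_cat; apply/and3P; split; apply/allP => _ /mapP[i _ ->];
  by have /and3P[] := H i.
apply/seq.permP => a; rewrite !map_cat !flatten_cat !count_cat.
by rewrite !count_flatten_codom count_vertices !big_split /= addnA.
Qed.

(** Each root moves one place along its chain, with [Q i] entering first. The sums of roots
    telescope, and the end roots left over are covered by the additional rainbow map. *)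
Lemma absorber_tileable Q A : absorber c r h Q A ->
  tileable (fun g : {ffun I -> V} => rainbow c h g) (vertices A ++ codom Q).
Proof.
move=> /andP[/forallP H Hw].
pose G0 i := upd r (A i).1.1 (Q i).
pose G1 i := upd r (A i).1.2 ((A i).1.1 r).
pose G2 i := upd r (A i).2 ((A i).1.2 r).
exists ([seq G0 i | i <- enum I] ++ [seq G1 i | i <- enum I] ++
  [seq G2 i | i <- enum I] ++ [:: [ffun i => (A i).2 r]]); split.
  rewrite !all_cat [all _ [:: _]]/= Hw !andbT; apply/and3P; split;
  apply/allP => _ /mapP[i _ ->];
  by have /and3P[/and3P[_ _ ?] /and3P[_ _ ?] /and3P[_ _ ?]] := H i.
apply/seq.permP => a; rewrite !map_cat !flatten_cat !count_cat.
rewrite !count_flatten_codom count_vertices /= ?cats0 ?count_cat ?addn0 [count a (codom Q)]count_codom [count a (codom (finfun _))]count_codom.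
have E0 : (\sum_i count a (codom (G0 i)) + \sum_i a ((A i).1.1 r) =
    \sum_i count a (codom (A i).1.1) + \sum_i a (Q i))%N.
  by rewrite -!big_split; apply: eq_bigr => i _; apply: count_upd.
have E1 : (\sum_i count a (codom (G1 i)) + \sum_i a ((A i).1.2 r) =
    \sum_i count a (codom (A i).1.2) + \sum_i a ((A i).1.1 r))%N.
  by rewrite -!big_split; apply: eq_bigr => i _; apply: count_upd.
have E2 : (\sum_i count a (codom (G2 i)) + \sum_i a ((A i).2 r) =
    \sum_i count a (codom (A i).2) + \sum_i a ((A i).1.2 r))%N.
  by rewrite -!big_split; apply: eq_bigr => i _; apply: count_upd.
have -> : (\sum_i a ([ffun i => (A i).2 r] i) = \sum_i a ((A i).2 r))%N.
  by apply: eq_bigr => i _; rewrite ffunE.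
rewrite !big_split /=; move: E0 E1 E2.
move: (\sum_i count a (codom (G0 i)))%N (\sum_i count a (codom (G1 i)))%N
  (\sum_i count a (codom (G2 i)))%N (\sum_i count a (codom (A i).1.1))%N
  (\sum_i count a (codom (A i).1.2))%N (\sum_i count a (codom (A i).2))%N
  (\sum_i a (Q i))%N (\sum_i a ((A i).1.1 r))%N (\sum_i a ((A i).1.2 r))%N
  (\sum_i a ((A i).2 r))%N => *; lia.
Qed.

(** Maps with a repeated vertex or a vertex in [W] are of lower order and take away at most half of
    the absorbers. *)
Lemma absorbers_avoiding (R : realFieldType) (Q : {ffun I -> V}) (W : {set V}) (z : R)
    (s := (3 * #|I| ^ 2)%N) : (0 < #|V|)%N ->
  z * #|V|%:R ^+ s <= #|[set A | absorber c r h Q A]|%:R ->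
  (s ^ 2 + s * #|W|)%:R <= z / 2 * #|V|%:R ->
  z / 2 * #|{: {ffun I -> triple V I}}|%:R <=
    #|[set A | [&& absorber c r h Q A, self_tiled A, uniq (vertices A) &
      all [predC W] (vertices A)]]|%:R.
Proof.
move=> V0 Hz HW; set n : R := #|V|%:R in HW Hz.
have n0 : 0 < n by rewrite ltr0n.
have -> : #|{: {ffun I -> triple V I}}|%:R = n ^+ s :> R.
  rewrite card_ffun !card_prod !card_ffun -!expnD -expnM natrX.
  by congr (_ ^+ _); rewrite /s !expnS expn0; lia.
set B := [set A | _] in Hz; set D := [set A | _].
pose N := [set A | ~~ avoiding W (flat A)].
have BND : (#|B| <= #|D| + #|N|)%N.
  apply: leq_trans (leq_card_setU _ _); apply: subset_leq_card.
  apply/subsetP => A; rewrite !inE => AA; rewrite AA (absorber_self_tiled AA) /=.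
  have -> : uniq (vertices A) = injectiveb (flat A) by [].
  rewrite /avoiding; case: (injectiveb _) => //=.
  case: (boolP [forall i, flat A i \notin W]) => [/forallP al|]; last by rewrite orbT.
  by rewrite orbF; apply/allP => x /codomP[j ->] /=; apply: al.
have Nn : #|N|%:R * n <= z / 2 * n * n ^+ s.
  apply: le_trans (_ : (s ^ 2 + s * #|W|)%:R * n ^+ s <= _); last first.
    by rewrite ler_wpM2r ?exprn_ge0 ?(ltW n0).
  rewrite -natrX -!natrM ler_nat.
  apply: leq_trans (_ : (#|[set B : {ffun I * (I + I + I) -> V} | ~~ avoiding W B]| * #|V| <= _)%N);
    last by have := card_not_avoiding (I * (I + I + I))%type W; rewrite card_flat.
  rewrite leq_mul2r; apply/orP; right; apply: (leq_card_bij (h := flat)).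
    by move=> A A' _ _; apply: flat_inj.
  by move=> A; rewrite !inE.
have {}Nn : #|N|%:R <= z / 2 * n ^+ s.
  by rewrite -(ler_pM2r n0); apply: le_trans Nn _; rewrite mulrAC.
have : #|B|%:R <= #|D|%:R + #|N|%:R :> R by rewrite -natrD ler_nat.
lra.
Qed.

End Absorbers.

(** * Covering and absorbing *)

(** With [C = t * f.+1] and [q] the quotient of [n %/ t] by [f.+1], one has [n <= C * q.+1]. Once
    [C ^ f <= q], it follows that [n ^ f <= q.+1 ^ f.+1 <= 2 ^ (q * f.+1)]. *)
Lemma expn_le_exp2_div (f t : nat) : (0 < t)%N ->
  exists n0, forall n, (n0 <= n)%N -> (n ^ f <= 2 ^ (n %/ t))%N.
Proof.
move=> t0; pose C := (t * f.+1)%N; exists (t * (f.+1 * C ^ f))%N => n nn.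
set N := (n %/ t)%N; pose q := (N %/ f.+1)%N.
have qC : (C ^ f <= q)%N by rewrite leq_divRL // mulnC leq_divRL // mulnC.
have nC : (n <= C * q.+1)%N.
  rewrite /C -mulnA; apply: leq_trans (ltnW (ltn_ceil n t0)) _.
  by rewrite mulnC leq_mul2l [(f.+1 * _)%N]mulnC ltn_ceil ?orbT.
apply: leq_trans (_ : (2 ^ q) ^ f.+1 <= _)%N; last first.
  by rewrite -expnM leq_exp2l // leq_trunc_div.
apply: leq_trans (_ : q.+1 ^ f.+1 <= _)%N; last by rewrite leq_exp2r // ltn_expl.
apply: leq_trans (_ : (C * q.+1) ^ f <= _)%N.
  by case: (f) => // f'; rewrite leq_exp2r.
by rewrite expnMn expnS leq_mul2r (leq_trans qC) ?orbT.
Qed.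

(** Follows from the Bernoulli-type bound [(1 - x) ^+ l * (1 + l%:R * x) <= 1]. *)
Lemma geometric_le (R : archiRealFieldType) (x a : R) : 0 < x <= 1 -> 0 < a ->
  exists l, (1 - x) ^+ l <= a.
Proof.
move=> /andP[x0 x1] a0.
have bern l : (1 - x) ^+ l * (1 + l%:R * x) <= 1.
  elim: l => [|l IH]; first by rewrite expr0 mul0r addr0 mulr1.
  apply: le_trans IH; rewrite exprSr -mulrA ler_wpM2l ?exprn_ge0 ?subr_ge0 //.
  rewrite -natr1 -subr_ge0.
  rewrite (_ : _ - _ = (l%:R + 1) * x ^+ 2); last by ring.
  by rewrite mulr_ge0 ?exprn_ge0 ?addr_ge0 // ltW.
exists (Num.bound (a^-1 / x)); set l := Num.bound _.
have lb : a^-1 <= l%:R * x.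
  by rewrite -ler_pdivrMr //; apply: ltW; apply: archi_boundP; rewrite divr_ge0 ?invr_ge0 ?ltW.
have l0 : 0 < 1 + l%:R * x by rewrite ltr_wpDr // mulr_ge0 // ltW.
rewrite -(ler_pM2r l0); apply: le_trans (bern l) _.
rewrite -(ler_pM2l (_ : 0 < a^-1)) ?invr_gt0 // mulrA mulVf ?gt_eqF // mul1r mulr1.
by apply: le_trans lb _; rewrite lerDr.
Qed.

Lemma chunks (V : Type) (f k : nat) (l : seq V) : (0 < f)%N -> size l = (f * k)%N ->
  exists Qs : seq {ffun 'I_f -> V}, size Qs = k /\
    flatten [seq codom q | q : {ffun 'I_f -> V} <- Qs] = l.
Proof.
move=> f0; elim: k l => [|k IH] l.
  by rewrite muln0 => /size0nil->; exists [::].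
rewrite mulnS => sl; have [|Qs [sQ fQ]] := IH (drop f l).
  by rewrite size_drop sl addKn.
have [x0 _] : exists x0 : V, True.
  by case: l sl {fQ} => [|x0 l] => [/eqP|]; [rewrite eq_sym addn_eq0 (gtn_eqF f0) | exists x0].
exists ([ffun i : 'I_f => nth x0 l i] :: Qs); rewrite /= sQ fQ; split=> //.
rewrite -[RHS](cat_take_drop f); congr (_ ++ _).
apply: (@eq_from_nth _ x0).
  by rewrite size_codom card_ord size_takel // sl leq_addr.
rewrite size_codom card_ord => i fi.
rewrite codomE (nth_map (Ordinal fi)) ?size_enum_ord // ffunE nth_enum_ord //.
by rewrite nth_take.
Qed.

(** Inside [U], taken as a type of its own, the rainbow maps outnumber the non-injective ones. *)
Lemma exists_copy (R : realFieldType) (V I : finType) (c : I -> 'I_3)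
    (h : V -> V -> V -> bool) (d : R) (U : {set V}) : 0 <= d ->
  d * #|U|%:R ^+ 3 <= triples R h U U U ->
  (#|I| ^ 2)%:R < d ^+ (#|I| ^ 3) * #|U|%:R ->
  exists g : {ffun I -> V}, [/\ rainbow c h g, injectiveb g & {subset codom g <= U}].
Proof.
move=> d0 tr big; pose T := {x : V | x \in U}.
have cT : #|{: T}| = #|U| by rewrite card_sig; apply: eq_card => x; rewrite inE.
pose h' (x y z : T) := h (val x) (val y) (val z).
have dens : d * (#|{: T}| ^ 3)%:R <= #|[set t : T * T * T | h' t.1.1 t.1.2 t.2]|%:R.
  rewrite cT natrX; apply: le_trans tr _; rewrite card_sumR.
  have sub (F : V -> R) : \sum_(x in U) F x = \sum_(x : T) F (val x).
    exact: big_sub.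
  rewrite le_eqVlt; apply/orP; left; apply/eqP.
  rewrite -(pair_big xpredT xpredT (fun (p : T * T) (z : T) => (h' p.1 p.2 z)%:R)) /=.
  rewrite -(pair_big xpredT xpredT (fun (x y : T) => \sum_(z : T) (h' x y z)%:R)) /=.
  by rewrite /triples sub; apply: eq_bigr => x _; rewrite sub; apply: eq_bigr => y _; rewrite sub.
have := rainbow_density c d0 dens.
have := card_not_avoiding I (set0 : {set T}); rewrite cards0 muln0 addn0 cT.
set N := [set g | _]; set B := [set g | _] => NB BB.
have [g gB gN] : exists2 g, g \in B & g \notin N.
  apply/subsetPn; apply/negP => /subset_leq_card BN.
  have U0 : (0 < #|U|)%N.
    by rewrite lt0n; apply/eqP => u0; move: big; rewrite u0 mulr0 ltNge ler0n.
  have : d ^+ (#|I| ^ 3) * #|U|%:R * (#|U| ^ #|I|)%:R <= (#|I| ^ 2)%:R * (#|U| ^ #|I|)%:R.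
    rewrite mulrAC -natrM; apply: le_trans (_ : #|N|%:R * #|U|%:R <= _).
      by rewrite ler_wpM2r //; apply: le_trans BB _; rewrite ler_nat.
    by rewrite -natrM ler_nat.
  by rewrite ler_pM2r ?ltr0n ?expn_gt0 ?U0 // leNgt big.
exists [ffun i => val (g i)]; move: gB gN; rewrite !inE negbK => rg /andP[ig _]; split.
- apply/rainbowP => i j k ci cj ck; rewrite !ffunE.
  by have /rainbowP/(_ i j k ci cj ck) := rg.
- apply/injectiveP => i j; rewrite !ffunE => /val_inj; exact: (injectiveP _ ig).
- by move=> x /codomP[i ->]; rewrite ffunE; apply: valP.
Qed.

Lemma greedy_cover (V I : finType) (P : pred {ffun I -> V}) (m : nat) : (0 < #|I|)%N ->
  (forall U : {set V}, (m <= #|U|)%N ->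
     exists g : {ffun I -> V}, [/\ P g, injectiveb g & {subset codom g <= U}]) ->
  forall U : {set V}, exists (gs : seq {ffun I -> V}) (L : {set V}),
    [/\ all P gs, (#|L| <= m)%N &
      perm_eq (flatten [seq codom g | g : {ffun I -> V} <- gs] ++ enum L) (enum U)].
Proof.
move=> I0 H U; have [k] := ubnP #|U|; elim: k U => // k IH U Uk.
have [Um|mU] := ltnP #|U| m.
  by exists [::], U; rewrite ltnW //=; split.
have [g [Pg ig sg]] := H U mU.
have uniqg : uniq (codom g) by [].
pose D := [set x in codom g].
have DU : D \subset U by apply/subsetP => x; rewrite inE => /sg.
have [|gs [L [a1 a2 a3]]] := IH (U :\: D).
  apply: leq_trans (_ : (#|U :\: D| < #|U|)%N) _; last by rewrite -ltnS.
  rewrite cardsD (setIidPr DU) ltn_subrL.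
  have D0 : (0 < #|D|)%N by rewrite cardsE (card_uniqP _) // size_codom.
  by rewrite D0 (leq_trans D0) ?subset_leq_card.
exists (g :: gs), L; rewrite /= Pg a1 a2; split=> //.
rewrite -catA; apply: perm_trans (perm_cat (perm_refl _) a3) _.
apply: uniq_perm; rewrite ?enum_uniq //.
  rewrite cat_uniq uniqg enum_uniq andbT /=; apply/hasPn => x.
  by rewrite mem_enum !inE => /andP[].
move=> x; rewrite mem_cat !mem_enum !inE.
by case: (boolP (x \in codom g)) => // /sg ->.
Qed.

(** Choose [l * k] disjoint absorbers, cover the other vertices greedily down to at most [f * k],
    and cut the rest into at most [k] tuples for absorption. *)
Lemma absorb_and_cover (R : realFieldType) (V : finType) (f : nat) (c : 'I_f -> 'I_3)
    (r : 'I_f) (h : V -> V -> V -> bool) (z : R) (k l w : nat)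
    (s := (3 * f ^ 2)%N) : 0 < z <= 1 -> (0 < #|V|)%N -> (f %| #|V|)%N ->
  (forall (Q : {ffun 'I_f -> V}) (W : {set V}), (#|W| <= w)%N ->
    z * #|{: {ffun 'I_f -> triple V 'I_f}}|%:R <=
    #|[set A | [&& absorber c r h Q A, self_tiled c h A, uniq (vertices A) &
      all [predC W] (vertices A)]]|%:R) ->
  (s * (l * k) <= w)%N -> (1 - z / 2) ^+ l <= 4^-1 -> (#|V| ^ f <= 2 ^ k)%N ->
  (forall U : {set V}, (f * k <= #|U|)%N -> exists g : {ffun 'I_f -> V},
    [/\ rainbow c h g, injectiveb g & {subset codom g <= U}]) ->
  tileable (fun g : {ffun 'I_f -> V} => rainbow c h g) (enum V).
Proof.
move=> /andP[z0 z1] V0 fV Habs sw ql Vk Hcov.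
have f0 : (0 < f)%N by apply: leq_ltn_trans (ltn_ord r).
have Q0 : (0 < #|{: {ffun 'I_f -> V}}|)%N by rewrite card_ffun expn_gt0 V0.
have S0 : (0 < #|{: {ffun 'I_f -> triple V 'I_f}}|)%N.
  by rewrite card_ffun !card_prod card_ffun expn_gt0 !muln_gt0 !expn_gt0 V0.
have z01 : 0 < z <= 1 by rewrite z0.
have szv A : size (vertices (V := V) (I := 'I_f) A) = s.
  by rewrite size_vertices card_ord.
have [As [gAs uAs szAs pot]] := greedy_family (w := w) (r := (l * k)%N) z01 Q0 S0 szv
  (fun W q HW => Habs q W HW) sw.
(* The final potential is at most [2 ^ k * 4^-1 ^+ k], that is [2^-1 ^+ k], while a tuple served
   fewer than [k] times would alone contribute more. *)
have cnt q : (k <= count (absorber c r h q) As)%N.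
  have h2 : 0 < (2^-1 : R) by rewrite invr_gt0 ltr0n.
  have h21 : (2^-1 : R) < 1 by rewrite invf_lt1 ?ltr1n ?ltr0n.
  rewrite -(ler_iXn2l h2 h21).
  apply: le_trans (_ : \sum_q (2^-1 : R) ^+ count (absorber c r h q) As <= _).
    by rewrite (bigD1 q) //= lerDl sumr_ge0 // => q' _; rewrite exprn_ge0 // ltW.
  apply: le_trans pot _; rewrite card_ffun card_ord exprM.
  apply: le_trans (_ : (2 ^ k)%:R * (4^-1 ^+ k) <= _).
    apply: ler_pM => //; rewrite ?ler_nat ?exprn_ge0 ?exprn_ge0 //; try lra.
    by apply: lerXn2r => //; rewrite nnegrE ?exprn_ge0 ?invr_ge0 //; lra.
  rewrite natrX -exprMn (_ : 2 * 4^-1 = 2^-1) //; by field.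
pose W := [set x in flatten (map (@vertices V 'I_f) As)].
have [gs [L [Pgs Lk pU]]] := greedy_cover (P := fun g : {ffun 'I_f -> V} => rainbow c h g)
  (m := (f * k)%N) (eq_ind_r (fun x => (0 < x)%N) f0 (card_ord f)) Hcov (~: W).
have pW : perm_eq (flatten (map (@vertices V 'I_f) As)) (enum W).
  by apply: uniq_perm; rewrite ?enum_uniq // => x; rewrite mem_enum inE.
have pV : perm_eq (enum W ++ enum (~: W)) (enum V).
  apply: uniq_perm; rewrite ?enum_uniq //.
    rewrite cat_uniq !enum_uniq andbT /=; apply/hasPn => x.
    by rewrite !mem_enum !inE.
  by move=> x; rewrite mem_cat !mem_enum !inE; case: (x \in flatten _).
(* [f] divides the number of all vertices, the size [s] of each absorber and the size of each
   copy. *)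
have fL : (f %| #|L|)%N.
  have := perm_size pV; rewrite size_cat -(perm_size pU) -(perm_size pW) size_cat -!cardE.
  rewrite !size_flatten /shape -!map_comp.
  rewrite (eq_map (g := fun=> s)); last by move=> A /=.
  rewrite [X in (_ + (sumn X + _))%N](eq_map (g := fun=> f)); last first.
    by move=> g /=; rewrite size_codom card_ord.
  rewrite !sumnE !big_map !big_const_seq !count_predT !iter_addn_0 => E.
  have fs : (f %| s)%N by apply/dvdn_mull/dvdn_exp.
  by move: fV; rewrite -E (dvdn_addr _ (dvdn_mulr _ fs)) (dvdn_addr _ (dvdn_mulr _ (dvdnn f))).
have [j Ej] : exists j, #|L| = (f * j)%N.
  by exists (#|L| %/ f)%N; rewrite mulnC divnK.
have [|Qs [sQ fQ]] := chunks (k := j) (l := enum L) f0; first by rewrite -cardE.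
have jk : (j <= k)%N by move: Lk; rewrite Ej leq_pmul2l.
have tl : tileable (fun g : {ffun 'I_f -> V} => rainbow c h g)
    (flatten (map (@vertices V 'I_f) As) ++ flatten [seq codom q | q : {ffun 'I_f -> V} <- Qs]).
  apply: (tileable_match (good := self_tiled c h) (serves := absorber c r h)) => //.
  - exact: self_tiled_tileable.
  - exact: absorber_tileable.
  - by move=> q; rewrite sQ (leq_trans jk).
have tg : tileable (fun g : {ffun 'I_f -> V} => rainbow c h g)
    (flatten [seq codom g | g : {ffun 'I_f -> V} <- gs]) by exists gs.
apply: tileable_perm (tileable_cat tl tg); rewrite fQ -catA.
apply: perm_trans pV; apply: perm_cat pW _.
by apply: perm_trans pU; rewrite perm_catC.
Qed.

(** * Hypergraphs on ordinals *)

Definition hedge (V : finType) (H : {set {set V}}) (x y z : V) := [set x; y; z] \in H.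

Lemma hedge_sym (V : finType) (H : {set {set V}}) : symmetric3 (hedge H).
Proof.
split=> x y z; rewrite /hedge; congr (_ \in H).
  by rewrite [[set x; y]]setUC.
by rewrite -!setUA; congr (_ :|: _); rewrite setUC.
Qed.

Lemma hedge_neq (V : finType) (H : {set {set V}}) x y z :
  is_kgraph 3 H -> hedge H x y z -> y != z.
Proof.
move=> H3 /H3; apply: contra_eq_neq => ->.
by rewrite -setUA setUid cards2; case: (x != z).
Qed.

(** An edge containing [y] and [z] is the image of its third vertex. *)
Lemma hedge_codegree (R : realType) (V : finType) (H : {set {set V}}) (a : R) :
  is_kgraph 3 H -> mindeg_ge 2 H a -> codegree_ge (hedge H) a.
Proof.
move=> H3 dH y z yz; have := dH [set y; z]; rewrite cards2 yz => /(_ erefl) le.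
apply: le_trans le _; rewrite -card_sumR ler_nat /deg.
apply: leq_trans (_ : #|[set [set x; y; z] | x in [set x | hedge H x y z]]| <= _)%N;
  last exact: leq_imset_card.
apply: subset_leq_card; apply/subsetP => e; rewrite inE => /andP[eH ye].
have /cards1P[x ex] : #|e :\: [set y; z]| == 1%N.
  by rewrite cardsD (setIidPr ye) cards2 yz (H3 e eH).
have eE : e = [set x; y; z].
  by rewrite -(setID e [set y; z]) (setIidPr ye) ex setUC setUA.
by apply/imsetP; exists x; rewrite // inE /hedge -eE.
Qed.

Lemma npmu3_triples (R : realType) (n : nat) (p mu : R) (H : {set {set 'I_n}})
    (X Y Z : {set 'I_n}) : npmu3 p mu H ->
  p * (#|X|%:R * #|Y|%:R * #|Z|%:R) - mu * #|'I_n|%:R ^+ 3 <= triples R (hedge H) X Y Z.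
Proof.
move=> /(_ X Y Z); rewrite card_ord !natrM => /le_trans; apply.
rewrite card_sumR.
rewrite -(pair_big xpredT xpredT (fun (p : 'I_n * 'I_n) (z : 'I_n) =>
  [&& p.1 \in X, p.2 \in Y, z \in Z & [set p.1; p.2; z] \in H]%:R)) /=.
rewrite -(pair_big xpredT xpredT (fun (x y : 'I_n) => \sum_(z : 'I_n)
  [&& x \in X, y \in Y, z \in Z & [set x; y; z] \in H]%:R)) /=.
rewrite /triples [leRHS]big_mkcond; apply: ler_sum => x _.
case: (x \in X); last by rewrite big1 // => y _; rewrite big1.
rewrite [leRHS]big_mkcond; apply: ler_sum => y _ /=.
case: (y \in Y); last by rewrite big1.
rewrite [leRHS]big_mkcond; apply: ler_sum => z _ /=.
by case: (z \in Z).
Qed.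

(* Permuting the classes puts the root in class 0. *)
Lemma partite_coloring (f : nat) (F : {set {set 'I_f}}) (r : 'I_f) :
  is_kgraph 3 F -> is_kpartite 3 F -> exists c : 'I_f -> 'I_3, val (c r) = 0%N /\
    forall e, e \in F -> exists i j k, [/\ e = [set i; j; k], val (c i) = 0%N,
      val (c j) = 1%N & val (c k) = 2%N].
Proof.
move=> F3 [c0 c0P]; pose c x := tperm (c0 r) ord0 (c0 x).
have cP e a : e \in F -> #|[set x in e | c x == a]| = 1%N.
  move=> eF; apply: etrans (c0P e eF (tperm (c0 r) ord0 a)); apply: eq_card => x.
  by rewrite !inE /c (can2_eq (@tpermK _ _ _) (@tpermK _ _ _)).
exists c; split; first by rewrite /c tpermL.
move=> e eF; pose b : 'I_3 := lift ord0 ord0.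
have pick1 a : exists2 x, x \in e & c x = a.
  have /eqP/cards1P[x] := cP e a eF; move=> /setP/(_ x); rewrite !inE eqxx.
  by move=> /andP[xe /eqP xa]; exists x.
have [i ie ci] := pick1 ord0; have [j je cj] := pick1 b; have [k ke ck] := pick1 ord_max.
exists i, j, k; rewrite ci cj ck; split=> //.
apply/esym/eqP; rewrite eqEcard (F3 e eF); apply/andP; split.
  by apply/subsetP => x; rewrite !inE => /orP[/orP[]|] /eqP->.
have ne x y : c x != c y -> x != y by apply: contraNneq => ->.
by rewrite -setUA cardsU1 cards2 !inE negb_or !ne ?ci ?cj ?ck.
Qed.

Lemma triplesT (R : realFieldType) (V : finType) (h : V -> V -> V -> bool) :
  triples R h setT setT setT = #|[set t : V * V * V | h t.1.1 t.1.2 t.2]|%:R.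
Proof.
rewrite card_sumR -(pair_big xpredT xpredT (fun (p : V * V) (z : V) => (h p.1 p.2 z)%:R)) /=.
rewrite -(pair_big xpredT xpredT (fun (x y : V) => \sum_(z : V) (h x y z)%:R)) /=.
have T (F : V -> R) : \sum_(x in setT) F x = \sum_x F x by apply: eq_bigl => x; rewrite inE.
by rewrite /triples T; apply: eq_bigr => x _; rewrite T; apply: eq_bigr => y _; rewrite T.
Qed.

Lemma rainbow_copy (f n : nat) (F : {set {set 'I_f}}) (H : {set {set 'I_n}})
    (c : 'I_f -> 'I_3) (g : {ffun 'I_f -> 'I_n}) :
  (forall e, e \in F -> exists i j k, [/\ e = [set i; j; k], val (c i) = 0%N,
      val (c j) = 1%N & val (c k) = 2%N]) ->
  rainbow c (hedge H) g -> injective g -> is_copy F H g.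
Proof.
move=> cF /rainbowP rg ig; split=> // e /cF[i [j [k [-> ci cj ck]]]].
by rewrite !imsetU !imset_set1; apply: rg.
Qed.

(** The enumeration of the vertices has no repetition, hence neither does the concatenation of the
    pieces: each piece is injective and distinct pieces are disjoint. *)
Lemma tileable_factor (f n : nat) (F : {set {set 'I_f}}) (H : {set {set 'I_n}})
    (P : pred {ffun 'I_f -> 'I_n}) : (0 < f)%N ->
  (forall g, P g -> injective g -> is_copy F H g) ->
  tileable P (enum 'I_n) -> has_factor F H.
Proof.
move=> f0 Pcopy [s [aP ps]].
have us : uniq (flatten [seq codom g | g : {ffun 'I_f -> 'I_n} <- s]).
  by rewrite (perm_uniq ps) enum_uniq.
have dis (t : seq {ffun 'I_f -> 'I_n}) :
    uniq (flatten [seq codom g | g : {ffun 'I_f -> 'I_n} <- t]) ->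
    (forall g, g \in t -> uniq (codom g)) /\
    (forall g1 g2, g1 \in t -> g2 \in t -> g1 != g2 -> [disjoint codom g1 & codom g2]).
  elim: t => //= g t IH; rewrite cat_uniq => /and3P[ug /hasPn no /IH[h1 h2]].
  have no' g' x : g' \in t -> x \in codom g' -> x \notin codom g.
    move=> gt xg; apply: no; apply/flattenP; exists (codom g') => //.
    by apply/mapP; exists g'.
  split=> [g'|g1 g2]; rewrite !inE; first by case/orP=> [/eqP->//|/h1].
  move=> /orP[/eqP->|g1t] /orP[/eqP->|g2t]; rewrite ?eqxx // => ne.
  - by rewrite disjoint_sym disjoint_subset; apply/subsetP => x /(no' _ _ g2t).
  - by rewrite disjoint_subset; apply/subsetP => x /(no' _ _ g1t).
  - exact: h2.
have [us1 us2] := dis s us.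
exists [set g in s]; split; [|split].
- move=> g; rewrite inE => gs; apply: Pcopy; first exact: (allP aP).
  exact/injectiveP/us1.
- by move=> g1 g2; rewrite !inE; apply: us2.
- move=> v; have : v \in flatten [seq codom g | g : {ffun 'I_f -> 'I_n} <- s].
    by rewrite (perm_mem ps) mem_enum.
  by move=> /flattenP[_ /mapP[g gs ->] vg]; exists g; rewrite ?inE.
Qed.

(** Makes the error [mu * n ^+ 3] harmless inside sets of size at least [k], which is of order
    [n / t]. *)
Lemma cube_scale (R : realFieldType) (t k n u : R) :
  0 < t -> 0 <= n -> n <= 2 * t * k -> 0 <= k -> k <= u ->
  1 / 8 / (2 * t) ^+ 3 * n ^+ 3 <= 1 / 8 * u ^+ 3.
Proof.
move=> t0 n0 nk k0 ku; have t2 : 0 < 2 * t by rewrite mulr_gt0 ?ltr0n.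
have h1 : n ^+ 3 <= (2 * t * u) ^+ 3.
  rewrite lerXn2r ?nnegrE //; first by rewrite mulr_ge0 ?(ltW t2) ?(le_trans k0).
  by apply: le_trans nk _; rewrite ler_pM2l.
apply: le_trans (_ : 1 / 8 / (2 * t) ^+ 3 * (2 * t * u) ^+ 3 <= _).
  by rewrite ler_wpM2l // !divr_ge0 // exprn_ge0 // ltW.
rewrite [(_ * u) ^+ 3]exprMn mulrA mulfVK //.
by rewrite expf_neq0 // gt_eqF.
Qed.

(** * Choice of the constants *)

Unset Implicit Arguments.

Theorem mainTheorem2 (R : realType) (eps alpha : R)
  (heps0 : 0 < eps) (heps1 : eps < 1) (halpha0 : 0 < alpha) (halpha1 : alpha < 1)
  (f : nat) (F : {set {set 'I_f}})
  (hF3 : is_kgraph 3 F) (hFp : is_kpartite 3 F) :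
  exists (n0 : nat) (mu : R), 0 < mu /\
    forall (n : nat) (H : {set {set 'I_n}}), (n0 <= n)%N ->
      is_kgraph 3 H ->
      npmu3 (1 / 8 + eps) mu H ->
      mindeg_ge 2 H (alpha * n%:R) ->
      (f %| n)%N ->
      has_factor F H.
Proof.
(* For [f = 0] divisibility forces [n = 0], which [n0 = 1] rules out. *)
have [f_eq0|f0] := posnP f.
  exists 1%N, 1; split=> // n H n1 _ _ _ fn.
  by have := dvdn_gt0 n1 fn; rewrite lt0n => /eqP; case.
pose r : 'I_f := Ordinal f0.
have [c [cr cF]] := partite_coloring r hF3 hFp.
have [eta [eta' [mu1 [eta0 eta'0 mu10 Hlink]]]] := linking_paths heps0 halpha0.
pose s := (3 * f ^ 2)%N.
pose q := eta' * (alpha * eta) ^+ (3 * f ^ 3).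
have q0 : 0 < q by rewrite mulr_gt0 // exprn_gt0 // mulr_gt0.
pose d := eps ^+ (f ^ 3); have d0 : 0 < d by rewrite exprn_gt0.
pose z0 := d * q ^+ f.
have z00 : 0 < z0 by rewrite mulr_gt0 // exprn_gt0.
(* Half of [z0] survives the avoidance of used vertices; [greedy_family] also asks for a proportion
   of at most 1. *)
pose z := Num.min (z0 / 2) 1.
have zp : 0 < z by rewrite lt_min ltr01 andbT divr_gt0 ?ltr0n.
have z1 : z <= 1 by rewrite /z ge_min lexx orbT.
have zz : z <= z0 / 2 by rewrite /z ge_min lexx.
clearbody z.
have [l ql] : exists l, (1 - z / 2) ^+ l <= 4^-1.
  by apply: geometric_le; rewrite ?invr_gt0 ?ltr0n //; apply/andP; split; lra.
have archi (x : R) : 0 <= x -> exists N, x <= N%:R.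
  by move=> x0; exists (Num.bound x); apply/ltW/archi_boundP.
(* With [k = n %/ t], this makes [s ^ 2 * l * k], the cost of avoiding the chosen absorbers, at most
   [z0 * n / 4]. Below, [N2] does the same for the term [s ^ 2]. *)
have [t1 Ht1] : exists N : nat, 4 * (s ^ 2 * l)%:R / z0 <= N%:R.
  by apply/archi/(divr_ge0 _ (ltW z00)); rewrite mulr_ge0.
(* Sets of more than [K0] vertices are large enough for [exists_copy]. *)
have [K0 HK0] : exists N : nat, ((f ^ 2)%:R + 1) / d <= N%:R.
  by apply/archi/(divr_ge0 _ (ltW d0)); rewrite addr_ge0.
have [N2 HN2] : exists N : nat, 4 * (s ^ 2)%:R / z0 <= N%:R.
  by apply/archi/(divr_ge0 _ (ltW z00)); rewrite mulr_ge0.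
pose t := t1.+1; have t0 : (0 < t)%N by [].
have [n1 Hn1] := expn_le_exp2_div f t0.
pose mu2 : R := 1 / 8 / (2 * t%:R) ^+ 3.
have mu20 : 0 < mu2 by rewrite !divr_gt0 ?ltr0n ?exprn_gt0 ?mulr_gt0 ?ltr0n.
(* The three bounds serve the linking of vertices, the count of rainbow maps on the whole vertex
   set, and the copies inside uncovered sets. *)
pose mu := Num.min (Num.min mu1 (1 / 8)) mu2.
have mu0 : 0 < mu by rewrite !lt_min mu10 mu20 divr_gt0 ?ltr0n.
have mule1 : mu <= mu1 by rewrite /mu !ge_min lexx.
have mule8 : mu <= 1 / 8 by rewrite /mu !ge_min lexx orbT.
have mule2 : mu <= mu2 by rewrite /mu !ge_min lexx orbT.
exists (2 + n1 + t * K0.+1 + N2)%N, mu; split=> //.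
move=> n H nbig H3 Hnp Hdeg fn.
have [n_gt1 n_n1 n_t n_N2] : [/\ 1 < n, n1 <= n, t * K0.+1 <= n & N2 <= n]%N.
  by move: nbig; move: (t * K0.+1)%N => a; clear; split; lia.
pose h := hedge H; pose k := (n %/ t)%N.
have kK : (K0 < k)%N by rewrite /k leq_divRL // mulnC.
have nR0 : 0 < n%:R :> R by rewrite ltr0n ltnW.
have kn : k%:R * t%:R <= n%:R :> R by rewrite -natrM ler_nat leq_trunc_div.
have nk : n%:R <= 2 * t%:R * k%:R :> R.
  have := ltn_ceil n t0; rewrite -/k => /ltnW lt.
  rewrite -!natrM ler_nat; apply: leq_trans lt _.
  (* Here [k >= 1] gives [k.+1 <= 2 * k]. *)
  by rewrite mulnAC leq_mul2r mul2n -addnn -addn1 leq_add2l (leq_trans _ kK) ?orbT.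
have cV : #|'I_n| = n by apply: card_ord.
have cI : #|'I_f| = f by apply: card_ord.
have lo (m : R) (X Y Z : {set 'I_n}) : mu <= m ->
    (1 / 8 + eps) * (#|X|%:R * #|Y|%:R * #|Z|%:R) - m * #|'I_n|%:R ^+ 3 <= triples R h X Y Z.
  move=> mum; apply: le_trans (npmu3_triples X Y Z Hnp).
  by rewrite lerD2l lerN2 ler_wpM2r // exprn_ge0.
have hne x y w : h x y w -> y != w by apply: hedge_neq.
have cod : codegree_ge h (alpha * #|'I_n|%:R) by rewrite cV; apply: hedge_codegree.
have V0 : (0 < #|'I_n|)%N by rewrite cV ltnW.
have V1 : (1 < #|'I_n|)%N by rewrite cV.
have links := Hlink _ h V1 (hedge_sym H) hne (fun X Y Z => lo mu1 X Y Z mule1) cod.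
have chains u w : q * #|'I_n|%:R ^+ (3 * #|'I_f|) <=
    #|'I_n|%:R * #|[set a | chain c r h u w a]|%:R.
  have := chain_count cr (ltW halpha0) (ltW eta0) V0 hne cod (links u w).
  by rewrite cI.
have rain : d * #|'I_n|%:R ^+ #|'I_f| <= #|[set g : {ffun 'I_f -> 'I_n} | rainbow c h g]|%:R.
  have := rainbow_density (T := 'I_n) (h := h) c (ltW heps0); rewrite -triplesT.
  rewrite cI !natrX cV; apply.
  have := lo (1 / 8) setT setT setT mule8; rewrite cardsT cV; apply: le_trans.
  rewrite le_eqVlt; apply/orP; left; apply/eqP; ring.
have absc Q : z0 * #|'I_n|%:R ^+ s <= #|[set A | absorber c r h Q A]|%:R.
  by have := absorber_count Q (ltW q0) V0 rain chains; rewrite cI.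
have tile : tileable (fun g : {ffun 'I_f -> 'I_n} => rainbow c h g) (enum 'I_n).
  apply: (absorb_and_cover (r := r) (z := z) (k := k) (l := l) (w := (s * (l * k))%N)) => //.
  - by rewrite zp z1.
  - by rewrite cV.
  - move=> Q W Ww; apply: le_trans (_ : z0 / 2 * #|{: {ffun 'I_f -> triple 'I_n 'I_f}}|%:R <= _).
      by rewrite ler_wpM2r.
    apply: absorbers_avoiding => //; rewrite cI //.
    apply: le_trans (_ : (s ^ 2 + s * (s * (l * k)))%:R <= _).
      by rewrite ler_nat leq_add2l leq_mul2l Ww orbT.
    rewrite cV; move: HN2 Ht1; rewrite !ler_pdivrMr // => HN2 Ht1.
    have e1 : 4 * (s ^ 2)%:R <= n%:R * z0.
      by apply: le_trans HN2 _; rewrite ler_pM2r // ler_nat.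
    have e2 : 4 * (s ^ 2 * l)%:R * k%:R <= n%:R * z0.
      apply: le_trans (_ : t%:R * z0 * k%:R <= _).
        rewrite ler_wpM2r //; apply: le_trans Ht1 _.
        by rewrite ler_pM2r // ler_nat leqnSn.
      by rewrite mulrAC ler_pM2r // mulrC.
    rewrite (_ : (s * (s * (l * k)) = s ^ 2 * l * k)%N); last by rewrite -mulnn !mulnA.
    rewrite natrD [(s ^ 2 * l * k)%:R]natrM.
    by move: e1 e2; move: (s ^ 2)%:R (s ^ 2 * l)%:R => a b; lra.
  - by rewrite cV; apply: Hn1.
  - move=> U fkU; apply: (@exists_copy R 'I_n 'I_f c h eps U).
    + exact: ltW.
    + apply: le_trans (lo mu2 U U U mule2); rewrite cV.
      have kU : k%:R <= #|U|%:R :> R.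
        by rewrite ler_nat; apply: leq_trans fkU; rewrite leq_pmull.
      have : mu2 * n%:R ^+ 3 <= 1 / 8 * #|U|%:R ^+ 3.
        by apply: (cube_scale _ (ltW nR0) nk (ler0n R k) kU); rewrite ltr0n.
      move: (mu2 * _) (#|U|%:R : R) => a b; clear.
      have -> : b * b * b = b ^+ 3 by ring.
      by move: (b ^+ 3) => x; lra.
    + rewrite cI -/d; move: HK0; rewrite ler_pdivrMr // => HK0.
      apply: lt_le_trans (_ : (f ^ 2)%:R + 1 <= _); first by rewrite ltrDl.
      apply: le_trans HK0 _; rewrite mulrC ler_pM2l // ler_nat.
      by apply: leq_trans (ltnW kK) _; apply: leq_trans fkU; rewrite leq_pmull.
apply: (tileable_factor f0 _ tile) => g rg ig; exact: (rainbow_copy cF rg ig).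
Qed.
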